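(* Let $(\mathfrak g,[-,-],(-)^{[p]})$ be a restricted Lie algebra and $A$ a commutative associative algebra over $\mathbf k$, and let $\rho:\mathfrak g\to\mathrm{Der}(A)$ be a homomorphism of restricted Lie algebras, where $\mathrm{Der}(A)$ is the Lie algebra of derivations of $A$ with $p$-map the $p$-th power $D\mapsto D^p$; write $x(b)$ for $\rho(x)(b)$. Define on $A\otimes\mathfrak g$, for $a,b\in A$ and $x,y\in\mathfrak g$, $$[a\otimes x,b\otimes y]:=ab\otimes[x,y],\qquad (a\otimes x)\rhd(b\otimes y):=a\,x(b)\otimes y,$$ and define a $p$-map on $A\otimes\mathfrak g$ by $(a\otimes x)^{[p]}:=a^p\otimes x^{[p]}$ on pure tensors, extended to finite sums of pure tensors by the rule $(u+v)^{[p]}=u^{[p]}+v^{[p]}+\sum_{i=1}^{p-1}s_i(u,v)$. Then $(A\otimes\mathfrak g,[-,-],(-)^{[p]},\rhd)$ is a restricted post-Lie algebra.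
   Context: Convention: $\mathbf k$ is an algebraically closed field of prime characteristic $p$; everything is over $\mathbf k$. Restricted Lie algebra: a Lie algebra $(\mathfrak g,[-,-])$ with a $p$-map $(-)^{[p]}:\mathfrak g\to\mathfrak g$ satisfying $(ax)^{[p]}=a^px^{[p]}$ for $a\in\mathbf k$, $[x^{[p]},y]=(\mathrm{ad}_x)^p(y)$, and $(x+y)^{[p]}=x^{[p]}+y^{[p]}+\sum_{i=1}^{p-1}s_i(x,y)$, where $i\,s_i(x,y)$ is the coefficient of $t^{i-1}$ in $(\mathrm{ad}_{tx+y})^{p-1}(x)\in\mathbf k[t]\otimes\mathfrak g$. Restricted Lie algebra homomorphisms are Lie algebra homomorphisms commuting with the $p$-maps. Post-Lie algebra: a Lie algebra $(\mathfrak g,[-,-])$ with a bilinear product $\rhd$ such that $x\rhd[y,z]=[x\rhd y,z]+[y,x\rhd z]$ and $([x,y]+x\rhd y-y\rhd x)\rhd z=x\rhd(y\rhd z)-y\rhd(x\rhd z)$. Coefficients $C_\alpha$: for a composition $\alpha=(\alpha_1,\dots,\alpha_r)\vDash n$ (a tuple of positive integers with sum $n$, of length $\ell(\alpha)=r$), $C_\alpha=\prod_{k=1}^r\binom{\alpha_1+\cdots+\alpha_k-1}{\alpha_k-1}$. Restricted post-Lie algebra $(\mathfrak g,[-,-],(-)^{[p]},\rhd)$: a post-Lie algebra $(\mathfrak g,[-,-],\rhd)$ such that $(\mathfrak g,[-,-],(-)^{[p]})$ is a restricted Lie algebra and, for all $x,y$, $y\rhd x^{[p]}=(\mathrm{ad}_x)^{p-1}(y\rhd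 x)$ and $x^{\llbracket p\rrbracket}\rhd y=\underbrace{x\rhd(x\rhd\cdots(x}_{p}\rhd y)\cdots)$, where $$x^{\llbracket p\rrbracket}=x^{[p]}+\sum_{r=1}^{p-1}\frac1r\sum_{\alpha\vDash p,\ \ell(\alpha)=r}C_\alpha\,[x^{\rhd\alpha_1},[x^{\rhd\alpha_2},[\cdots[x^{\rhd\alpha_{r-1}},x^{\rhd\alpha_r}]\cdots]]],$$ with $x^{\rhd k}=x\rhd(x\rhd\cdots(x\rhd x)\cdots)$ ($k$ copies of $x$, $x^{\rhd1}=x$), and $\frac1r$ the inverse of $r$ modulo $p$. *)

(* Defs.v *)
From HB Require Import structures.
From mathcomp Require Import all_boot all_order all_algebra.
From mathcomp Require Import boolp.

Set Implicit Arguments.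
Unset Strict Implicit.
Unset Printing Implicit Defensive.

Import GRing.Theory.
Local Open Scope ring_scope.
Local Open Scope quotient_scope.

Notation bilinear f := (bilinear_for *:%R *:%R f).

Section TensorProduct.
Variables (k : fieldType) (U V : lmodType k).

(* The sequence [:: (u1, v1); ...; (un, vn)] stands for the formal sum
   u1 (x) v1 + ... + un (x) vn. *)
Inductive tensor_rel : seq (U * V) -> seq (U * V) -> Prop :=
| trel_refl s : tensor_rel s s
| trel_sym s t : tensor_rel s t -> tensor_rel t s
| trel_trans s t r : tensor_rel s t -> tensor_rel t r -> tensor_rel s r
| trel_cat s s' t t' :
    tensor_rel s s' -> tensor_rel t t' -> tensor_rel (s ++ t) (s' ++ t')
| trel_catC s t : tensor_rel (s ++ t) (t ++ s)
| trel_0l v : tensor_rel [:: (0, v)] [::]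
| trel_Dl u u' v : tensor_rel [:: (u + u', v)] [:: (u, v); (u', v)]
| trel_Dr u v v' : tensor_rel [:: (u, v + v')] [:: (u, v); (u, v')]
| trel_Z c u v : tensor_rel [:: (c *: u, v)] [:: (u, c *: v)].

Definition tensor_relb (s t : seq (U * V)) : bool := `[< tensor_rel s t >].

Fact tensor_relb_refl : reflexive tensor_relb.
Proof. by move=> s; apply/asboolP; apply: trel_refl. Qed.

Fact tensor_relb_sym : symmetric tensor_relb.
Proof. by move=> s t; apply/asboolP/asboolP; apply: trel_sym. Qed.

Fact tensor_relb_trans : transitive tensor_relb.
Proof.
move=> t s r /asboolP st /asboolP tr; apply/asboolP.
exact: trel_trans st tr.
Qed.

Canonical tensor_equiv :=
  EquivRel tensor_relb tensor_relb_refl tensor_relb_sym tensor_relb_trans.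

Definition tensor : Type := {eq_quot tensor_equiv}.
HB.instance Definition _ := Choice.on tensor.
HB.instance Definition _ := Quotient.on tensor.

Definition tens (u : U) (v : V) : tensor := \pi_tensor [:: (u, v)].

Lemma tensor_eqP (s t : seq (U * V)) :
  tensor_rel s t <-> \pi_tensor s = \pi_tensor t.
Proof. by split=> [st | /eqmodP /asboolP //]; apply/eqmodP/asboolP. Qed.

Lemma tensor_repr (s : seq (U * V)) : tensor_rel (repr (\pi_tensor s)) s.
Proof. by apply/tensor_eqP; rewrite reprK. Qed.

Lemma tensorP (x : tensor) : exists s, x = \pi_tensor s.
Proof. by exists (repr x); rewrite reprK. Qed.

Definition tensor_map (f : U -> U) (s : seq (U * V)) : seq (U * V) :=
  [seq (f w.1, w.2) | w <- s].

Definition tensor_zero : tensor := \pi_tensor [::].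
Definition tensor_add (x y : tensor) : tensor := \pi_tensor (repr x ++ repr y).
Definition tensor_opp (x : tensor) : tensor := \pi_tensor (tensor_map -%R (repr x)).
Definition tensor_scale (c : k) (x : tensor) : tensor :=
  \pi_tensor (tensor_map ( *:%R c) (repr x)).

Lemma tensor_map_rel f : linear f ->
  forall s t, tensor_rel s t -> tensor_rel (tensor_map f s) (tensor_map f t).
Proof.
move=> lf s t; have fD u u' : f (u + u') = f u + f u'.
  by rewrite -[u]scale1r lf !scale1r.
have f0 : f 0 = 0 by apply: (addrI (f 0)); rewrite -fD !addr0.
have fZ c u : f (c *: u) = c *: f u by rewrite -[_ *: u]addr0 lf f0 addr0.
elim=> {s t} [s|s t _ IH|s t r _ IH _ IH'|s s' t t' _ IH _ IH'|s t|v|u u' v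
             |u v v'|c u v] /=.
- exact: trel_refl.
- exact: trel_sym.
- exact: trel_trans IH IH'.
- by rewrite /tensor_map !map_cat; apply: trel_cat.
- by rewrite /tensor_map !map_cat; apply: trel_catC.
- by rewrite /= f0; apply: trel_0l.
- by rewrite /= fD; apply: trel_Dl.
- exact: trel_Dr.
- by rewrite /= fZ; apply: trel_Z.
Qed.

Lemma tensor_addE s t : tensor_add (\pi_tensor s) (\pi_tensor t) = \pi_tensor (s ++ t).
Proof. by apply/tensor_eqP/trel_cat; apply: tensor_repr. Qed.

Lemma tensor_mapE f s : linear f ->
  \pi_tensor (tensor_map f (repr (\pi_tensor s))) = \pi_tensor (tensor_map f s).
Proof. by move=> lf; apply/tensor_eqP/tensor_map_rel/tensor_repr. Qed.

Fact opp_linear : linear (-%R : U -> U).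
Proof. by move=> c u v; rewrite opprD scalerN. Qed.

Fact scale_linear c : linear ( *:%R c : U -> U).
Proof. by move=> d u v; rewrite scalerDr !scalerA mulrC. Qed.

Lemma tensor_oppE s : tensor_opp (\pi_tensor s) = \pi_tensor (tensor_map -%R s).
Proof. exact: (tensor_mapE _ opp_linear). Qed.

Lemma tensor_scaleE c s :
  tensor_scale c (\pi_tensor s) = \pi_tensor (tensor_map ( *:%R c) s).
Proof. exact: (tensor_mapE _ (@scale_linear c)). Qed.

Lemma tensor_addA : associative tensor_add.
Proof.
move=> x y z; case: (tensorP x) (tensorP y) (tensorP z) => s -> [t ->] [r ->].
by rewrite !tensor_addE catA.
Qed.

Lemma tensor_addC : commutative tensor_add.
Proof.
move=> x y; case: (tensorP x) (tensorP y) => s -> [t ->]; rewrite !tensor_addE.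
exact/tensor_eqP/trel_catC.
Qed.

Lemma tensor_add0 : left_id tensor_zero tensor_add.
Proof. by move=> x; case: (tensorP x) => s ->; rewrite tensor_addE. Qed.

Lemma tensor_map_sum f g h s : (forall u, f u = g u + h u) ->
  tensor_rel (tensor_map f s) (tensor_map g s ++ tensor_map h s).
Proof.
move=> fE; elim: s => [|[u v] s IH] /=; first exact: trel_refl.
apply: (trel_trans (t := [:: (g u, v); (h u, v)] ++
          (tensor_map g s ++ tensor_map h s))).
  rewrite -cat1s; apply: trel_cat => //=; rewrite fE; exact: trel_Dl.
rewrite /= -cat1s -[X in tensor_rel _ X]cat1s; apply: trel_cat.
  exact: trel_refl.
rewrite -cat1s -[X in tensor_rel _ (_ ++ X)]cat1s !catA; apply: trel_cat.
  exact: trel_catC.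
exact: trel_refl.
Qed.

Lemma tensor_map0 s : tensor_rel (tensor_map (fun=> 0) s) [::].
Proof.
elim: s => [|[u v] s IH] /=; first exact: trel_refl.
by rewrite -cat1s -[X in tensor_rel _ X]cat0s; apply: trel_cat IH; apply: trel_0l.
Qed.

Lemma tensor_addN : left_inverse tensor_zero tensor_opp tensor_add.
Proof.
move=> x; case: (tensorP x) => s ->; rewrite tensor_oppE tensor_addE; apply/tensor_eqP.
apply: trel_trans (tensor_map0 s); apply: trel_sym.
rewrite -[X in _ ++ X](_ : tensor_map id s = _); last first.
  by rewrite /tensor_map -[RHS]map_id; apply: eq_map => -[].
by apply: tensor_map_sum => u; rewrite addNr.
Qed.

HB.instance Definition _ := GRing.isZmodule.Build tensor
  tensor_addA tensor_addC tensor_add0 tensor_addN.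

Lemma tensor_scaleA a b x :
  tensor_scale a (tensor_scale b x) = tensor_scale (a * b) x.
Proof.
case: (tensorP x) => s ->; rewrite !tensor_scaleE /tensor_map -map_comp.
by congr (\pi _); apply: eq_map => w /=; rewrite scalerA.
Qed.

Lemma tensor_scale1 : left_id 1 tensor_scale.
Proof.
move=> x; case: (tensorP x) => s ->; rewrite tensor_scaleE /tensor_map -[X in _ = \pi_tensor X]map_id.
by congr (\pi _); apply: eq_map => -[u v] /=; rewrite scale1r.
Qed.

Lemma tensor_scaleDr : right_distributive tensor_scale +%R.
Proof.
move=> a x y; case: (tensorP x) (tensorP y) => s -> [t ->]; rewrite [_ + _]tensor_addE !tensor_scaleE.
by rewrite [RHS]tensor_addE /tensor_map map_cat.
Qed.

Lemma tensor_scaleDl x : {morph tensor_scale^~ x : a b / a + b}.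
Proof.
move=> a b; case: (tensorP x) => s ->; rewrite !tensor_scaleE [RHS]tensor_addE.
by apply/tensor_eqP/tensor_map_sum => u; rewrite scalerDl.
Qed.

HB.instance Definition _ := GRing.Zmodule_isLmodule.Build k tensor
  tensor_scaleA tensor_scale1 tensor_scaleDr tensor_scaleDl.

Lemma tens_bilinear : bilinear tens.
Proof.
split=> [v|u] c w w'; rewrite /tens [X in _ = X + _]tensor_scaleE [RHS]tensor_addE.
  exact/tensor_eqP/trel_Dl.
apply/tensor_eqP; apply: trel_trans (trel_Dr _ _ _) _.
rewrite -cat1s -[X in tensor_rel _ X]cat1s; apply: trel_cat.
  exact/trel_sym/trel_Z.
exact: trel_refl.
Qed.

Lemma tensor_sumE (x : tensor) : x = \sum_(w <- repr x) tens w.1 w.2.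
Proof.
rewrite -[LHS]reprK; elim: (repr x) => [|[u v] s IH]; first by rewrite big_nil.
by rewrite big_cons -IH /= [RHS]tensor_addE.
Qed.

End TensorProduct.

Arguments tens {k U V} u v.

Lemma tensor_universal (k : fieldType) (U V W : lmodType k)
    (f : U -> V -> W) : bilinear f ->
  exists F : {linear tensor U V -> W},
    (forall u v, F (tens u v) = f u v) /\
    (forall G : {linear tensor U V -> W},
       (forall u v, G (tens u v) = f u v) -> G =1 F).
Proof.
case=> fl fr; pose S (s : seq (U * V)) := \sum_(w <- s) f w.1 w.2.
have fDl u u' v : f (u + u') v = f u v + f u' v.
  by have := fl v 1 u u'; rewrite /= !scale1r.
have fDr u v v' : f u (v + v') = f u v + f u v'.
  by have := fr u 1 v v'; rewrite /= !scale1r.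
have f0l v : f 0 v = 0 by apply: (addrI (f 0 v)); rewrite -fDl !addr0.
have f0r u : f u 0 = 0 by apply: (addrI (f u 0)); rewrite -fDr !addr0.
have fZl c u v : f (c *: u) v = c *: f u v.
  by have := fl v c u 0; rewrite /= f0l !addr0.
have fZr c u v : f u (c *: v) = c *: f u v.
  by have := fr u c v 0; rewrite /= f0r !addr0.
have SE s t : tensor_rel s t -> S s = S t.
  elim=> {s t} [//|s t _ -> //|s t r _ -> _ -> //|s s' t t' _ IH _ IH'|s t|v
     |u u' v|u v v'|c u v]; rewrite /S ?big_cat ?big_cons ?big_nil /= ?addr0 //.
  - by rewrite -!/(S _) IH IH'.
  - by rewrite addrC.
  - by rewrite fZl fZr.
pose F (x : tensor U V) := S (repr x).
have FE s : F (\pi_(tensor U V) s) = S s by apply: SE; apply: tensor_repr.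
have Flin : linear F.
  move=> c x y; case: (tensorP x) (tensorP y) => s -> [t ->].
  rewrite [_ *: _]tensor_scaleE.
  rewrite [_ + _]tensor_addE !FE {1}/S big_cat -!/(S _); congr (_ + _).
  rewrite /S scaler_sumr /tensor_map big_map; apply: eq_bigr => w _.
  by rewrite fZl.
pose m := GRing.isLinear.Build k _ _ _ F Flin.
pose FL : {linear tensor U V -> W} := HB.pack F m.
exists FL; split=> [u v|G GE x].
  by rewrite /= FE /S big_cons big_nil addr0.
rewrite [x]tensor_sumE !linear_sum /=; apply: eq_bigr => w _.
by rewrite GE FE /S big_cons big_nil addr0.
Qed.

Section LieAlgebras.
Variables (k : fieldType) (g : lmodType k).
Implicit Types (br rhd : g -> g -> g) (pm : g -> g).

Record lie_algebra br : Prop := LieAlgebra {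
  lie_bilinear : bilinear br;
  lie_alternating : forall x, br x x = 0;
  lie_jacobi : forall x y z, br x (br y z) + br y (br z x) + br z (br x y) = 0
}.

(* An element of k[t] (x) g is represented by its coefficient function
   nat -> g; [ad_txy br x y] is the operator ad_{t x + y} on those. *)
Definition ad_txy br (x y : g) (f : nat -> g) (n : nat) : g :=
  (if n is m.+1 then br x (f m) else 0) + br y (f n).

Definition const_coef (x : g) (n : nat) : g := if n == 0%N then x else 0.

Definition s_term (p : nat) br (i : nat) (x y : g) : g :=
  i%:R^-1 *: iter p.-1 (ad_txy br x y) (const_coef x) i.-1.

Definition pmap_additive_rule (p : nat) br pm : Prop := forall x y,
  pm (x + y) = pm x + pm y + \sum_(1 <= i < p) s_term p br i x y.

Record restricted_lie_algebra (p : nat) br pm : Prop := RestrictedLieAlgebra {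
  rlie_lie : lie_algebra br;
  rlie_scale : forall (a : k) x, pm (a *: x) = a ^+ p *: pm x;
  rlie_ad : forall x y, br (pm x) y = iter p (br x) y;
  rlie_add : pmap_additive_rule p br pm
}.

Record post_lie_algebra br rhd : Prop := PostLieAlgebra {
  plie_lie : lie_algebra br;
  plie_bilinear : bilinear rhd;
  plie_der : forall x y z,
    rhd x (br y z) = br (rhd x y) z + br y (rhd x z);
  plie_assoc : forall x y z,
    rhd (br x y + rhd x y - rhd y x) z = rhd x (rhd y z) - rhd y (rhd x z)
}.

(* x^{|> n} for n > 0 *)
Definition rhd_pow rhd (x : g) (n : nat) : g := iter n.-1 (rhd x) x.

Fixpoint nested_bracket br rhd (x : g) (alpha : seq nat) : g :=
  match alpha with
  | [::] => 0
  | [:: a] => rhd_pow rhd x a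
  | a :: alpha' => br (rhd_pow rhd x a) (nested_bracket br rhd x alpha')
  end.

Definition is_composition (n : nat) (alpha : seq nat) : bool :=
  all (leq 1) alpha && (sumn alpha == n).

Definition comp_coef (alpha : seq nat) : nat :=
  (\prod_(i < size alpha)
     'C((sumn (take i.+1 alpha)).-1, (nth 0 alpha i).-1))%N.

(* The parts of a composition of p are at most p, so those of length r are
   among the r-tuples over 'I_p.+1. *)
Definition sub_pmap (p : nat) br pm rhd (x : g) : g :=
  pm x + \sum_(1 <= r < p) r%:R^-1 *:
    \sum_(alpha : r.-tuple 'I_p.+1 | is_composition p (map val alpha))
      (comp_coef (map val alpha))%:R *:
        nested_bracket br rhd x (map val alpha).

Record restricted_post_lie_algebra (p : nat) br pm rhd : Prop :=
  RestrictedPostLieAlgebra {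
  rplie_post_lie : post_lie_algebra br rhd;
  rplie_restricted : restricted_lie_algebra p br pm;
  rplie_rhd_pmap : forall x y,
    rhd y (pm x) = iter p.-1 (br x) (rhd y x);
  rplie_sub_pmap : forall x y,
    rhd (sub_pmap p br pm rhd x) y = iter p (rhd x) y
}.

End LieAlgebras.

Section CurrentAlgebra.
Variables (k : fieldType) (A g : lmodType k).

(* No unit is required. *)
Record comm_assoc_algebra (mul : A -> A -> A) : Prop := CommAssocAlgebra {
  calg_bilinear : bilinear mul;
  calg_assoc : associative mul;
  calg_comm : commutative mul
}.

Record derivation (mul : A -> A -> A) (D : A -> A) : Prop := Derivation {
  der_linear : linear D;
  der_leibniz : forall a b, D (mul a b) = mul (D a) b + mul a (D b)
}.

(* rho is a homomorphism of restricted Lie algebras from g to Der(A), where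
   Der(A) has the commutator bracket and the p-map D |-> D^p. *)
Record restricted_der_hom (p : nat) (br : g -> g -> g) (pm : g -> g)
    (mul : A -> A -> A) (rho : g -> A -> A) : Prop := RestrictedDerHom {
  rdh_der : forall x, derivation mul (rho x);
  rdh_linear : forall (c : k) x y a,
    rho (c *: x + y) a = c *: rho x a + rho y a;
  rdh_br : forall x y a,
    rho (br x y) a = rho x (rho y a) - rho y (rho x a);
  rdh_pm : forall x a, rho (pm x) a = iter p (rho x) a
}.

(* a^n for n > 0 *)
Definition alg_pow (mul : A -> A -> A) (a : A) (n : nat) : A :=
  iter n.-1 (mul a) a.

(* The formulas on pure tensors defining the three operations on A (x) g,
   together with the rules by which they extend to all of A (x) g. *)
Record current_operations (p : nat) (br : g -> g -> g) (pm : g -> g)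
    (mul : A -> A -> A) (rho : g -> A -> A)
    (brT : tensor A g -> tensor A g -> tensor A g)
    (pmT : tensor A g -> tensor A g)
    (rhdT : tensor A g -> tensor A g -> tensor A g) : Prop :=
  CurrentOperations {
  cur_br_bilinear : bilinear brT;
  cur_br : forall a b x y,
    brT (tens a x) (tens b y) = tens (mul a b) (br x y);
  cur_rhd_bilinear : bilinear rhdT;
  cur_rhd : forall a b x y,
    rhdT (tens a x) (tens b y) = tens (mul a (rho x b)) y;
  cur_pm : forall a x, pmT (tens a x) = tens (alg_pow mul a p) (pm x);
  cur_pm_add : pmap_additive_rule p brT pmT
}.

End CurrentAlgebra.

(* Main.v *)
Require Import Defs.
From mathcomp Require Import all_boot all_order all_algebra.
From mathcomp Require boolp.
Import Defs.

Set Implicit Arguments.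
Unset Strict Implicit.
Unset Printing Implicit Defensive.

Import GRing.Theory.
Local Open Scope ring_scope.
Local Open Scope quotient_scope.

(** Everything is reduced to Jacobson's formula: for a representation [X] of a
    Lie algebra in characteristic [p],
      [X_{x+y}^p = X_x^p + X_y^p + X_{L(x,y)}], [L(x,y) = sum_i s_i(x,y)].
    - In the extension of a Lie algebra by a derivation [D] it gives
      [D L(x,y) = ad_{x+y}^{p-1} D(x+y) - ad_x^{p-1} D x - ad_y^{p-1} D y].
      For the Euler operator on [k[s] (x) L] this shows that [L] is symmetric
      and a 2-cocycle, which is what makes the [p]-map on [A (x) g] well
      defined; for [D = y |> -] it gives the formula for [y |> x^{[p]}].
    - Splitting off the last part of a composition, Pascal's rule shows that
      [(t ad_x + d)^{n-1} x], where [d = x |> -], is the sum over [alpha] of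
      [t^{l(alpha)-1} C_alpha] times the nested brackets; so the correction
      term of [x^{[[p]]}] is [L(x, d)].
    - On [(k + A) (x) A], let [theta_{a (x) x} = a (x) rho(x)] and let [d] act
      on the left factor. Multiplication intertwines [theta_x + d] with the
      derivation of [A] given by [x], so Jacobson's formula computes the
      [p]-th power of that derivation. *)

(** * Elementary rules for linear and bilinear maps *)

Section Linear.
Variables (k : fieldType) (U V : lmodType k) (f : U -> V) (lf : linear f).

Lemma linD u v : f (u + v) = f u + f v.
Proof. by have := lf 1 u v; rewrite !scale1r. Qed.

Lemma lin0 : f 0 = 0.
Proof. by apply: (addrI (f 0)); rewrite -linD !addr0. Qed.

Lemma linZ c u : f (c *: u) = c *: f u.
Proof. by rewrite -[_ *: u]addr0 lf lin0 addr0. Qed.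

Lemma linN u : f (- u) = - f u.
Proof. by rewrite -scaleN1r linZ scaleN1r. Qed.

Lemma linB u v : f (u - v) = f u - f v.
Proof. by rewrite linD linN. Qed.

Lemma linMn n u : f (u *+ n) = f u *+ n.
Proof. by rewrite -!scaler_nat linZ. Qed.

Lemma lin_sum I (r : seq I) (P : pred I) F :
  f (\sum_(i <- r | P i) F i) = \sum_(i <- r | P i) f (F i).
Proof. exact: (big_morph f linD lin0). Qed.

End Linear.

Section Bilinear.
Variables (k : fieldType) (U V W : lmodType k).
Variables (f : U -> V -> W) (bf : bilinear f).

Lemma bilinr u : linear (f u).
Proof. exact: bf.2. Qed.

Lemma bilinDl u u' v : f (u + u') v = f u v + f u' v.
Proof. exact: (linD (bf.1 v)). Qed.

Lemma bilinDr u v v' : f u (v + v') = f u v + f u v'.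
Proof. exact: (linD (bf.2 u)). Qed.

Lemma bilin0l v : f 0 v = 0.
Proof. exact: (lin0 (bf.1 v)). Qed.

Lemma bilin0r u : f u 0 = 0.
Proof. exact: (lin0 (bf.2 u)). Qed.

Lemma bilinZl c u v : f (c *: u) v = c *: f u v.
Proof. exact: (linZ (bf.1 v)). Qed.

Lemma bilinZr c u v : f u (c *: v) = c *: f u v.
Proof. exact: (linZ (bf.2 u)). Qed.

Lemma bilinNl u v : f (- u) v = - f u v.
Proof. exact: (linN (bf.1 v)). Qed.

Lemma bilinNr u v : f u (- v) = - f u v.
Proof. exact: (linN (bf.2 u)). Qed.

End Bilinear.

(** * Jacobson's formula *)

Section PrimeCharacteristic.
Variables (k : fieldType) (p : nat) (hp : p \in [pchar k]).

Lemma pchar_scale (W : lmodType k) n (w : W) : (p %| n)%N -> w *+ n = 0.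
Proof.
by rewrite (dvdn_pcharf hp) -scaler_nat => /eqP ->; rewrite scale0r.
Qed.

Lemma pchar_natf_neq0 n : (0 < n < p)%N -> (n%:R : k) != 0.
Proof.
by case/andP=> n0 np; rewrite -(dvdn_pcharf hp) gtnNdvd.
Qed.

End PrimeCharacteristic.

Section Jacobson.

(* Formal series over a module are functions [nat -> W]; [polyop a b] is the
   operator [t a + b] on them, so that [ad_txy br x y] is convertible to
   [polyop (br x) (br y)]. *)
Definition polyop (W : zmodType) (a b : W -> W) (f : nat -> W) (n : nat) : W :=
  (if n is m.+1 then a (f m) else 0) + b (f n).

Lemma eq_polyop (W : zmodType) (a b : W -> W) f f' :
  f =1 f' -> forall n, polyop a b f n = polyop a b f' n.
Proof. by move=> ff' [|n]; rewrite /polyop !ff'. Qed.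

(* The sum of the [s_i] with [ad_x] and [ad_y] replaced by arbitrary maps. *)
Definition jacobson_sum (k : fieldType) (L : lmodType k) (p : nat)
    (a b : L -> L) (u : L) : L :=
  \sum_(1 <= i < p) i%:R^-1 *: iter p.-1 (polyop a b) (const_coef u) i.-1.

Variables (k : fieldType) (L V : lmodType k).
Variables (X : L -> V -> V) (Y : V -> V) (u : L) (a b : L -> L).
Hypotheses (bX : bilinear X) (lY : linear Y).
(** As operators these are the commutators of [X w] with [X u] and with [Y]. Leaving [Y] arbitrary
    covers [Y = X y] as well as operators of another origin. *)
Hypothesis Xa : forall w v, X (a w) v = X u (X w v) - X w (X u v).
Hypothesis Xb : forall w v, X (b w) v = Y (X w v) - X w (Y v).

Let lX := bilinr bX.
Let Z : (nat -> V) -> nat -> V := polyop (X u) Y.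
Let c j : nat -> L := iter j (polyop a b) (const_coef u).
Let conv (d : nat -> L) (F : nat -> V) (n : nat) : V :=
  \sum_(i < n.+1) X (d i) (F (n - i)%N).

(** [conv d F] is the product of the operator series [X d] with [F]; moving [t X_u + Y] past [X d]
    leaves the commutator, which is [X] of [(t a + b) d]. *)
Lemma conv_polyop d F n :
  Z (conv d F) n = conv (polyop a b d) F n + conv d (Z F) n.
Proof.
have -> : conv (polyop a b d) F n =
    (\sum_(i < n) X (a (d i)) (F (n.-1 - i)%N)) +
    \sum_(i < n.+1) X (b (d i)) (F (n - i)%N).
  rewrite /conv /polyop; under eq_bigr do rewrite (bilinDl bX).
  rewrite big_split /=; congr (_ + _).
  rewrite big_ord_recl (bilin0l bX) add0r; apply: eq_bigr => i _ /=.
  by rewrite /bump add1n subnS -!subn1 subnAC.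
have -> : conv d (Z F) n =
    (\sum_(i < n) X (d i) (X u (F (n.-1 - i)%N))) +
    \sum_(i < n.+1) X (d i) (Y (F (n - i)%N)).
  rewrite /conv /Z /polyop; under eq_bigr do rewrite (bilinDr bX).
  rewrite big_split /=; congr (_ + _).
  rewrite big_ord_recr /= subnn (bilin0r bX) addr0; apply: eq_bigr => i _ /=.
  case: n i => [[]//|n] i /=.
  by rewrite subSn // -ltnS.
have -> : Z (conv d F) n =
    (\sum_(i < n) X u (X (d i) (F (n.-1 - i)%N))) +
    \sum_(i < n.+1) Y (X (d i) (F (n - i)%N)).
  rewrite /Z /polyop /conv (lin_sum lY); congr (_ + _).
  by case: n => [|n]; rewrite ?big_ord0 // (lin_sum (lX u)).
rewrite addrACA -!big_split /=; congr (_ + _); apply: eq_bigr => i _.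
  by rewrite Xa subrK.
by rewrite Xb subrK.
Qed.

(* The derivative in [t] of [(t U + Y)^n v], where [U = X u]: moving [U] to the
   left past powers of [t U + Y] produces the iterated commutators [c j]. *)
Lemma deriv_iter_polyop v n m :
  iter n Z (const_coef v) m.+1 *+ m.+1 =
  \sum_(j < n) conv (c j) (iter (n - j.+1) Z (const_coef v)) m *+ 'C(n, j.+1).
Proof.
elim: n m => [|n IH] m; first by rewrite big_ord0 mul0rn.
set w := const_coef v.
have conv0 F i : conv (c 0) F i = X u (F i).
  rewrite /conv big_ord_recl subn0 big1 ?addr0 // => j _.
  by rewrite (bilin0l bX).
(* Product rule for the derivative in t of [(t X_u + Y) F]. *)
have dZ F : Z F m.+1 *+ m.+1 =
    X u (F m) + Z (fun i => F i.+1 *+ i.+1) m.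
  rewrite /Z /polyop mulrnDl addrA (linMn lY); congr (_ + _).
  case: m {IH} => [|m]; first by rewrite mulr1n addr0.
  by rewrite (linMn (lX u)) mulrS.
rewrite iterS dZ [Z _ m](eq_polyop (X u) Y IH m).
rewrite big_ord_recl subSS subn0 -/w bin1 mulrS conv0 -addrA; congr (_ + _).
have Zsum : polyop (X u) Y (fun i : nat => \sum_(j < n)
      conv (c j) (iter (n - j.+1) Z (const_coef v)) i *+ 'C(n, j.+1)) m =
    \sum_(j < n) Z (conv (c j) (iter (n - j.+1) Z w)) m *+ 'C(n, j.+1).
  rewrite /Z /polyop (lin_sum lY); under [RHS]eq_bigr do rewrite mulrnDl.
  rewrite big_split /=; congr (_ + _); last first.
    by apply: eq_bigr => j _; rewrite (linMn lY).
  case: m {IH dZ} => [|m]; first by rewrite big1 // => j _; rewrite mul0rn.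
  by rewrite (lin_sum (lX u)); apply: eq_bigr => j _; rewrite (linMn (lX u)).
rewrite Zsum; under eq_bigr do rewrite conv_polyop mulrnDl.
(* One sum raises the commutator index j, the other the power of [Z]; Pascal's rule recombines
   them. *)
rewrite big_split /= addrC.
under [in RHS]eq_bigr do rewrite /bump add1n subSS binS mulrnDr.
rewrite big_split /= addrA; congr (_ + _).
case: n {IH Zsum} => [|n]; first by rewrite !big_ord0 addr0.
rewrite -conv0 big_ord_recl [in RHS]big_ord_recr /=.
rewrite (@bin_small n.+1 n.+2) // mulr0n addr0.
rewrite subSS subn0 bin1; congr (_ *+ _ + _).
by apply: eq_bigr => j _; rewrite /bump add1n -iterS subSS subSn.
Qed.

Lemma iter_polyop_small v n m : (n < m)%N -> iter n Z (const_coef v) m = 0.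
Proof.
elim: n m => [|n IH] [|m] //= nm; rewrite /Z /polyop !IH ?(lin0 lY) ?addr0 //.
  exact: lin0 (lX u).
exact: ltn_trans (ltnSn n) nm.
Qed.

Lemma iter_polyop_lead v n : iter n Z (const_coef v) n = iter n (X u) v.
Proof.
elim: n => // n IH; rewrite !iterS {1}/Z /polyop IH iter_polyop_small //.
by rewrite (lin0 lY) addr0.
Qed.

Lemma iter_polyop0 v n : iter n Z (const_coef v) 0 = iter n Y v.
Proof. by elim: n => // n IH; rewrite !iterS {1}/Z /polyop IH add0r. Qed.

Lemma iter_polyop_sum v n :
  \sum_(i < n.+1) iter n Z (const_coef v) i = iter n (fun w => X u w + Y w) v.
Proof.
elim: n => [|n IH]; first by rewrite big_ord1.
rewrite /= -IH {1}/Z /polyop big_split /=; congr (_ + _).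
  by rewrite big_ord_recl add0r (lin_sum (lX u)).
rewrite big_ord_recr /= iter_polyop_small // (lin0 lY) addr0.
by rewrite (lin_sum lY).
Qed.

Variables (p : nat) (hp : p \in [pchar k]).

(** Evaluate [(t X_u + Y)^p v] at t = 1. Degrees 0 and p give the two p-th powers. For 0 < i < p, i
    times the coefficient of t^i is given by [deriv_iter_polyop]: p divides every binomial there
    except the last, so only [X (c p.-1 i.-1) v] remains, and i is invertible. *)
Theorem jacobson v :
  iter p (fun w => X u w + Y w) v =
  iter p (X u) v + iter p Y v + X (jacobson_sum p a b u) v.
Proof.
have pr := pcharf_prime hp; have p0 := prime_gt0 pr.
rewrite -iter_polyop_sum -(big_mkord xpredT (iter p Z (const_coef v))).
rewrite big_nat_recr //= big_ltn //= iter_polyop0 iter_polyop_lead.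
rewrite addrC addrA; congr (_ + _).
rewrite /jacobson_sum (lin_sum (bX.1 v)); apply: eq_big_nat => -[//|i] ip.
have nz := pchar_natf_neq0 hp ip.
rewrite (bilinZl bX); apply: (scalerI nz); rewrite scalerA divff // scale1r.
rewrite scaler_nat deriv_iter_polyop.
case: p p0 pr hp {ip nz} => // q _ pr hq.
rewrite big_ord_recr big1 /= => [|j _]; last first.
  by rewrite (pchar_scale hq) // prime_dvd_bin //= ltnS ltn_ord.
rewrite add0r subnn binn mulr1n /conv big_ord_recr big1 /= => [|j _].
  by rewrite subnn add0r.
by rewrite -[(i - j)%N]prednK ?subn_gt0 // (bilin0r bX).
Qed.

End Jacobson.

Definition s_sum (k : fieldType) (L : lmodType k) (p : nat)
    (br : L -> L -> L) (x y : L) : L :=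
  \sum_(1 <= i < p) s_term p br i x y.

Lemma jacobson_rep (k : fieldType) (p : nat) (L V : lmodType k)
    (br : L -> L -> L) (X : L -> V -> V) :
  p \in [pchar k] -> bilinear X ->
  (forall x y v, X (br x y) v = X x (X y v) - X y (X x v)) ->
  forall x y v, iter p (X (x + y)) v =
    iter p (X x) v + iter p (X y) v + X (s_sum p br x y) v.
Proof.
move=> hp bX XE x y v.
rewrite -(jacobson bX (bilinr bX y) (XE x) (XE y) hp).
by apply: eq_iter => w; rewrite (bilinDl bX).
Qed.

(* Index [d] stands for homogeneous degree [d + 1]: the relation is propagated
   through [p - 1] brackets starting from [x], of degree 1. *)
Lemma s_sum_rel (k : fieldType) (p : nat) (L L' : lmodType k)
    (br : L -> L -> L) (br' : L' -> L' -> L') (R : nat -> L -> L' -> Prop)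
    (x y : L) (x' y' : L') :
  (forall d, R d 0 0) ->
  (forall d z z' w w', R d z z' -> R d w w' -> R d (z + w) (z' + w')) ->
  (forall d c z z', R d z z' -> R d (c *: z) (c *: z')) ->
  (forall d z z', R d z z' -> R d.+1 (br x z) (br' x' z')) ->
  (forall d z z', R d z z' -> R d.+1 (br y z) (br' y' z')) ->
  R 0 x x' -> R p.-1 (s_sum p br x y) (s_sum p br' x' y').
Proof.
move=> R0 RD RZ Rx Ry Rxx; rewrite /s_sum.
apply: (big_ind2 (R p.-1)) => // [z z' w w'|i _]; first exact: RD.
apply: RZ; move: i.-1; elim: p.-1 => [|n IH] [|j] //=; apply: RD => //.
- exact: Ry.
- exact: Rx.
- exact: Ry.
Qed.

Lemma s_sum_commute (k : fieldType) (p : nat) (L : lmodType k)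
    (br : L -> L -> L) (x y : L) : (1 < p)%N -> bilinear br ->
  br x x = 0 -> br y x = 0 -> s_sum p br x y = 0.
Proof.
move=> p1 bb xx yx; apply: big1_seq => i _; rewrite /s_term.
suff -> : iter p.-1 (ad_txy br x y) (const_coef x) i.-1 = 0 by rewrite scaler0.
case: p p1 => [|[|p]] //= _; move: i.-1; elim: p => [|p IH] j /=.
  by case: j => [|[|j]]; rewrite /ad_txy /const_coef /= ?xx ?yx ?(bilin0r bb) addr0.
by rewrite {1}/ad_txy IH; case: j => [|j]; rewrite ?IH !(bilin0r bb) addr0.
Qed.

(** * Derivations and Jacobson's polynomial *)

Section LieAlgebra.
Variables (k : fieldType) (L : lmodType k) (br : L -> L -> L).
Hypothesis hL : lie_algebra br.
Let bb := lie_bilinear hL.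

Lemma lie_anticomm x y : br x y = - br y x.
Proof.
apply/eqP; rewrite -addr_eq0; apply/eqP.
have := lie_alternating hL (x + y).
by rewrite (bilinDl bb) !(bilinDr bb) !(lie_alternating hL) add0r addr0.
Qed.

Lemma lie_ad_br x y z : br (br x y) z = br x (br y z) - br y (br x z).
Proof.
have := lie_jacobi hL x y z.
rewrite (lie_anticomm z x) (lie_anticomm z (br x y)) (bilinNr bb).
by move/eqP; rewrite subr_eq0 => /eqP ->.
Qed.

Variables (p : nat) (hp : p \in [pchar k]).
Variables (D : L -> L).
Hypotheses (lD : linear D)
  (DE : forall x y, D (br x y) = br (D x) y + br x (D y)).

(* Jacobson's formula in the adjoint representation of the extension of [L]
   by [D], evaluated at [D]. *)
Lemma derivation_s_sum x y : D (s_sum p br x y) =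
  iter p.-1 (br (x + y)) (D (x + y)) -
  iter p.-1 (br x) (D x) - iter p.-1 (br y) (D y).
Proof.
(* The pair [(z, c)] stands for [z + c D], and [X w] is the adjoint action of [w], with [[w, D] = -
   D w]. *)
pose X (w : L) (z : L * k^o) : L * k^o := (br w z.1 - z.2 *: D w, 0).
have bX : bilinear X.
  split=> [z c w w'|w c z z']; congr (_, _) => /=; rewrite ?scaler0 ?addr0 //.
    rewrite lD (bilinDl bb) (bilinZl bb) !scalerDr !scalerN opprD addrACA.
    by rewrite !scalerA [_.2 * c]mulrC.
  rewrite (bilinDr bb) (bilinZr bb) scalerDl opprD addrACA.
  by rewrite scalerDr scalerN scalerA.
have XE w w' z : X (br w w') z = X w (X w' z) - X w' (X w z).
  congr (_, _) => /=; last by rewrite subr0.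
  rewrite !scale0r !subr0 !(bilinDr bb) !(bilinNr bb) !(bilinZr bb) DE lie_ad_br.
  rewrite (lie_anticomm (D w) w') scalerDr scalerN !opprD !opprK addrACA.
  by rewrite addrACA [in RHS]addrACA [X in _ + X]addrC.
have XD n w : iter n.+1 (X w) (0, 1) = (- iter n (br w) (D w), 0).
  elim: n => [|n IH].
    by rewrite /= /X /= (bilin0r bb) add0r scale1r.
  by rewrite iterS IH /X /= scale0r subr0 (bilinNr bb).
have pE : p = p.-1.+1 by rewrite prednK // prime_gt0 // (pcharf_prime hp).
have := jacobson_rep hp bX XE x y (0, 1).
rewrite {1 2 3}pE !XD /X /= (bilin0r bb) scale1r add0r => -[].
move=> /(congr1 -%R); rewrite !opprD !opprK => -> _.
by rewrite -addrA -opprD addrC addKr.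
Qed.

End LieAlgebra.

(** * Maps on tensor products *)

Section TensorMaps.
Variables (k : fieldType).

Lemma tensor_ind (U V : lmodType k) (P : tensor U V -> Prop) :
  (forall u v, P (tens u v)) -> (forall x y, P x -> P y -> P (x + y)) ->
  forall x, P x.
Proof.
move=> Pt PD x; rewrite [x]tensor_sumE.
(* The empty sum is the pure tensor [tens 0 0]. *)
apply: big_ind => // ; rewrite -(bilin0l (tens_bilinear U V) 0); exact: Pt.
Qed.

Lemma tens0l (U V : lmodType k) (v : V) : tens (0 : U) v = 0.
Proof. exact: (bilin0l (tens_bilinear U V)). Qed.

Lemma tens0r (U V : lmodType k) (u : U) : tens u (0 : V) = 0.
Proof. exact: (bilin0r (tens_bilinear U V)). Qed.

Lemma tensDl (U V : lmodType k) (u u' : U) (v : V) :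
  tens (u + u') v = tens u v + tens u' v.
Proof. exact: (bilinDl (tens_bilinear U V)). Qed.

Lemma tensDr (U V : lmodType k) (u : U) (v v' : V) :
  tens u (v + v') = tens u v + tens u v'.
Proof. exact: (bilinDr (tens_bilinear U V)). Qed.

Lemma tensZl (U V : lmodType k) c (u : U) (v : V) :
  tens (c *: u) v = c *: tens u v.
Proof. exact: (bilinZl (tens_bilinear U V)). Qed.

Lemma tensZr (U V : lmodType k) c (u : U) (v : V) :
  tens u (c *: v) = c *: tens u v.
Proof. exact: (bilinZr (tens_bilinear U V)). Qed.

Lemma linear_tensor_eq (U V W : lmodType k) (f g : tensor U V -> W) :
  linear f -> linear g -> (forall u v, f (tens u v) = g (tens u v)) -> f =1 g.
Proof.
move=> lf lg fg; apply: tensor_ind => // x y fx fy.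
by rewrite (linD lf) (linD lg) fx fy.
Qed.

(** A formula on representatives makes linearity in [f] visible, as [tlift_param_linear] needs;
    independence of the representative comes from [tensor_universal]. *)
Definition tlift (U V W : lmodType k) (f : U -> V -> W) (x : tensor U V) : W :=
  \sum_(w <- repr x) f w.1 w.2.

Lemma tliftP (U V W : lmodType k) (f : U -> V -> W) : bilinear f ->
  linear (tlift f) /\ forall u v, tlift f (tens u v) = f u v.
Proof.
move=> /tensor_universal [F [FE _]].
have tE : tlift f =1 F.
  move=> x; rewrite {2}[x]tensor_sumE linear_sum; apply: eq_bigr => w _.
  by rewrite FE.
by split=> [c x y|u v]; rewrite !tE ?linearP ?FE.
Qed.

Lemma tlift_linear (U V W : lmodType k) (f : U -> V -> W) :
  bilinear f -> linear (tlift f).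
Proof. by case/tliftP. Qed.

Lemma tliftE (U V W : lmodType k) (f : U -> V -> W) u v :
  bilinear f -> tlift f (tens u v) = f u v.
Proof. by case/tliftP. Qed.

Lemma tlift_param_linear (U V W M : lmodType k) (f : M -> U -> V -> W) :
  (forall u v, linear (fun m => f m u v)) ->
  forall x, linear (fun m => tlift (f m) x).
Proof.
move=> lf x c m m'; rewrite /tlift scaler_sumr -big_split /=.
by apply: eq_bigr => w _; rewrite lf.
Qed.

Section Map.
Variables (U U' V : lmodType k) (f : U -> U').
Definition tmap : tensor U V -> tensor U' V := tlift (fun u v => tens (f u) v).

Hypothesis lf : linear f.

Lemma tmap_bilinear : bilinear (fun u (v : V) => tens (f u) v).
Proof.
split=> [v c u u'|u c v v'] /=; first by rewrite lf tensDl tensZl.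
by rewrite tensDr tensZr.
Qed.

Lemma tmap_linear : linear tmap.
Proof. exact/tlift_linear/tmap_bilinear. Qed.

Lemma tmapE u v : tmap (tens u v) = tens (f u) v.
Proof. exact: (tliftE u v tmap_bilinear). Qed.

End Map.

Section Map2.
Variables (U U' U'' V V' V'' : lmodType k).
Variables (f : U -> U' -> U'') (h : V -> V' -> V'').

Definition tmap2 (x : tensor U V) (y : tensor U' V') : tensor U'' V'' :=
  tlift (fun u v => tlift (fun u' v' => tens (f u u') (h v v')) y) x.

Hypotheses (bf : bilinear f) (bh : bilinear h).

Let inner u v : bilinear (fun u' v' => tens (f u u') (h v v')).
Proof.
split=> [v' c w w'|u' c w w'] /=.
  by rewrite (bilinDr bf) (bilinZr bf) tensDl tensZl.
by rewrite (bilinDr bh) (bilinZr bh) tensDr tensZr.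
Qed.

Let outer y : bilinear (fun u v => tlift (fun u' v' => tens (f u u') (h v v')) y).
Proof.
split=> [v|u]; [pose F m u' v' := tens (f m u') (h v v') |
                pose F m u' v' := tens (f u u') (h m v')].
  apply: (@tlift_param_linear _ _ _ _ F) => u' v' c w w'.
  by rewrite /F (bilinDl bf) (bilinZl bf) tensDl tensZl.
apply: (@tlift_param_linear _ _ _ _ F) => u' v' c w w'.
by rewrite /F (bilinDl bh) (bilinZl bh) tensDr tensZr.
Qed.

Lemma tmap2_bilinear : bilinear tmap2.
Proof.
split=> [y|x]; first exact: tlift_linear (outer y).
pose F m u v := tlift (fun u' v' => tens (f u u') (h v v')) m.
apply: (@tlift_param_linear _ _ _ _ F) => u v; exact: tlift_linear (inner u v).
Qed.

Lemma tmap2E u v u' v' :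
  tmap2 (tens u v) (tens u' v') = tens (f u u') (h v v').
Proof. by rewrite /tmap2 (tliftE u v (outer _)) (tliftE _ _ (inner u v)). Qed.

End Map2.
End TensorMaps.

(** * The Lie algebra A (x) L *)

Section CurrentLie.
Variables (k : fieldType) (A L : lmodType k).
Variables (mul : A -> A -> A) (br : L -> L -> L).
Hypotheses (hA : comm_assoc_algebra mul) (hL : lie_algebra br).
Let bm := calg_bilinear hA.
Let bb := lie_bilinear hL.
Let brT := tmap2 mul br.
Let bT : bilinear brT := tmap2_bilinear bm bb.
Let brTE a u b v : brT (tens a u) (tens b v) = tens (mul a b) (br u v) :=
  tmap2E bm bb a u b v.

Lemma current_lie : lie_algebra brT.
Proof.
have anti x y : brT x y = - brT y x.
  move: x; apply: tensor_ind => [a u|x x' IH IH']; last first.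
    by rewrite (bilinDl bT) (bilinDr bT) IH IH' opprD.
  move: y; apply: tensor_ind => [b v|y y' IH IH']; last first.
    by rewrite (bilinDl bT) (bilinDr bT) IH IH' opprD.
  rewrite !brTE (calg_comm hA) (lie_anticomm hL).
  by rewrite -scaleN1r tensZr scaleN1r.
split=> // [|x y z].
  apply: tensor_ind => [a u|x y IH IH'].
    by rewrite brTE (lie_alternating hL) tens0r.
  by rewrite (bilinDl bT) !(bilinDr bT) IH IH' add0r addr0 anti addNr.
(* The Jacobi identity is additive in its first argument and invariant under rotation, so all three
   arguments may be taken to be pure tensors. *)
pose J x y z := brT x (brT y z) + brT y (brT z x) + brT z (brT x y) = 0.
rewrite -/(J x y z).
have JD x1 x2 y1 z1 : J x1 y1 z1 -> J x2 y1 z1 -> J (x1 + x2) y1 z1.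
  rewrite /J !(bilinDl bT) !(bilinDr bT) => J1 J2.
  by rewrite [X in X + (_ + _)]addrACA [LHS]addrACA J1 J2 addr0.
have Jrot x1 y1 z1 : J x1 y1 z1 -> J y1 z1 x1 by rewrite /J -addrA addrC.
move: x; apply: tensor_ind => [a u|x1 x2 J1 J2]; last exact: JD.
move: y; apply: tensor_ind => [b v|y1 y2 J1 J2]; last first.
  by do 2!apply: (Jrot); apply: JD; apply: (Jrot).
move: z; apply: tensor_ind => [c w|z1 z2 J1 J2]; last first.
  by apply: (Jrot); apply: JD; do 2!apply: (Jrot).
have mulE x y z : mul (mul x y) z = mul (mul z x) y.
  by rewrite (calg_comm hA) (calg_assoc hA).
rewrite /J !brTE !(calg_assoc hA) (mulE b c a) -(mulE a b c) -!tensDr.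
by rewrite (lie_jacobi hL) tens0r.
Qed.

Lemma tmap_derivation (d : A -> A) : derivation mul d ->
  forall x y, tmap d (brT x y) = brT (tmap d x) y + brT x (tmap d y).
Proof.
case=> ld dE x y; have lT := tmap_linear (V := L) ld.
move: x; apply: tensor_ind => [a u|x x' IH IH']; last first.
  by rewrite (bilinDl bT) !(linD lT) IH IH' !(bilinDl bT) addrACA.
move: y; apply: tensor_ind => [b v|y y' IH IH']; last first.
  by rewrite (bilinDr bT) !(linD lT) IH IH' !(bilinDr bT) addrACA.
by rewrite brTE !(tmapE ld) dE tensDl !brTE.
Qed.

End CurrentLie.

(** * Symmetry and cocycle identity *)

Section Cocycle.
Variables (k : fieldType) (p : nat) (hp : p \in [pchar k]).
Variables (L : lmodType k) (br : L -> L -> L) (hL : lie_algebra br).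
Let bb := lie_bilinear hL.

Let B : lmodType k := {poly k}.
Let mulB : B -> B -> B := fun q r => q * r.

Let hB : comm_assoc_algebra mulB.
Proof.
split=> [|q r s|q r]; rewrite /mulB ?mulrA //; last by rewrite mulrC.
split=> [r|r] c q q' /=; first by rewrite mulrDl scalerAl.
by rewrite mulrDr scalerAr.
Qed.
Let bB := calg_bilinear hB.

Let brS := tmap2 mulB br.
Let hS : lie_algebra brS := current_lie hB hL.
Let bS : bilinear brS := lie_bilinear hS.

Let euler (q : B) : B := 'X * q^`().

Let euler_der : derivation mulB euler.
Proof.
split=> [c q r|q r]; rewrite /euler /mulB.
  by rewrite derivD derivZ mulrDr scalerAr.
by rewrite derivM mulrDr mulrA mulrCA.
Qed.

Let E : tensor B L -> tensor B L := tmap euler.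
Let E_linear : linear E := tmap_linear (der_linear euler_der).

Let coefT n : tensor B L -> L := tlift (fun (q : B) l => q`_n *: l).
Let evT c : tensor B L -> L := tlift (fun (q : B) l => q.[c] *: l).

Let coef_bilinear n : bilinear (fun (q : B) (l : L) => q`_n *: l).
Proof.
split=> [l|q] c w w' /=; first by rewrite coefD coefZ scalerDl scalerA.
by rewrite scalerDr !scalerA mulrC.
Qed.

Let ev_bilinear x : bilinear (fun (q : B) (l : L) => q.[x] *: l).
Proof.
split=> [l|q] c w w' /=; first by rewrite hornerD hornerZ scalerDl scalerA.
by rewrite scalerDr !scalerA mulrC.
Qed.

Let coef_linear n : linear (coefT n) := tlift_linear (coef_bilinear n).
Let ev_linear x : linear (evT x) := tlift_linear (ev_bilinear x).

Let coefTE n q u : coefT n (tens q u) = q`_n *: u :=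
  tliftE q u (coef_bilinear n).
Let evTE x q u : evT x (tens q u) = q.[x] *: u := tliftE q u (ev_bilinear x).

Let ev_br x f h : evT x (brS f h) = br (evT x f) (evT x h).
Proof.
have lx := ev_linear x.
move: f; apply: tensor_ind => [q u|f f' IH IH']; last first.
  by rewrite (bilinDl bS) !(linD lx) IH IH' (bilinDl bb).
move: h; apply: tensor_ind => [r v|h h' IH IH']; last first.
  by rewrite (bilinDr bS) !(linD lx) IH IH' (bilinDr bb).
rewrite /brS (tmap2E bB bb) !evTE.
by rewrite /mulB hornerM (bilinZl bb) (bilinZr bb) scalerA.
Qed.

Let coef_E n f : coefT n (E f) = n%:R *: coefT n f.
Proof.
move: f; apply: tensor_ind => [q u|f f' IH IH']; last first.
  by rewrite (linD E_linear) !(linD (coef_linear n)) IH IH' scalerDr.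
rewrite /E (tmapE (der_linear euler_der)) !coefTE.
rewrite /euler coefXM scalerA; case: n => [|n]; first by rewrite mul0r.
by rewrite coef_deriv /= mulr_natl.
Qed.

Let coef0 f : coefT 0 f = evT 0 f.
Proof.
apply: (linear_tensor_eq (coef_linear 0) (ev_linear 0)) => q u.
by rewrite coefTE evTE horner_coef0.
Qed.

(** Any large enough bound is allowed so that two summands can share one. *)
Let ev1_coef f : exists N, forall M, (N <= M)%N ->
  evT 1 f = \sum_(n < M) coefT n f.
Proof.
move: f; apply: tensor_ind => [q u|f f' [N HN] [N' HN']]; last first.
  exists (maxn N N') => M; rewrite geq_max => /andP[NM N'M].
  rewrite (linD (ev_linear 1)) (HN M) // (HN' M) // -big_split /=.
  by apply: eq_bigr => i _; rewrite (linD (coef_linear i)).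
exists (size q) => M qM; rewrite evTE (horner_coef_wide _ qM).
rewrite scaler_suml; apply: eq_bigr => i _.
by rewrite coefTE expr1n mulr1.
Qed.

(* A tensor killed by the Euler operator has coefficients only in degrees
   divisible by [p]. *)
Let ev1_eq0 f : E f = 0 -> evT 0 f = 0 ->
  (forall n, (p <= n)%N -> coefT n f = 0) -> evT 1 f = 0.
Proof.
move=> Ef f0 fp; have [N /(_ _ (leqnn N)) ->] := ev1_coef f.
(* Degrees from p on vanish by hypothesis, degree 0 by the value at 0, and in between n is
   invertible, so [coef_E] applies. *)
apply: big1 => -[n _] _ /=; have [/fp //|np] := leqP p n.
case: n np => [|n] np; first by rewrite coef0.
apply: (scalerI (pchar_natf_neq0 hp (n := n.+1) np)); rewrite -coef_E Ef scaler0.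
exact: lin0 (coef_linear _).
Qed.

(** The polynomial [s u + v] with coefficients in [L]. *)
Let lin u v : tensor B L := tens 'X u + tens 1 v.

Let ev_lin x u v : evT x (lin u v) = x *: u + v.
Proof.
by rewrite (linD (ev_linear x)) !evTE hornerX hornerC scale1r.
Qed.

Let coef_br_lin u v f n : coefT n.+1 (brS (lin u v) f) =
  br u (coefT n f) + br v (coefT n.+1 f).
Proof.
move: f; apply: tensor_ind => [q w|f f' IH IH']; last first.
  rewrite (bilinDr bS) !(linD (coef_linear _)) IH IH' !(bilinDr bb).
  by rewrite addrACA.
rewrite /lin (bilinDl bS) (linD (coef_linear _)) /brS !(tmap2E bB bb).
rewrite !coefTE /mulB coefXM mul1r /=.
by rewrite !(bilinZr bb).
Qed.

(** Evaluation is a Lie homomorphism; its graph serves as the relation in [s_sum_rel], in every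
    degree. *)
Let ev_s_sum x u v u' v' : evT x (s_sum p brS (lin u v) (lin u' v')) =
  s_sum p br (x *: u + v) (x *: u' + v').
Proof.
apply: (@s_sum_rel _ p _ _ brS br (fun _ f z => evT x f = z)) => //.
- by move=> _; apply: lin0 (ev_linear x).
- by move=> _ f z h w <- <- /=; rewrite (linD (ev_linear x)).
- by move=> _ c f z <-; rewrite (linZ (ev_linear x)).
- by move=> _ f z <-; rewrite ev_br ev_lin.
- by move=> _ f z <-; rewrite ev_br ev_lin.
Qed.

Let p1 := prime_gt1 (pcharf_prime hp).

Let s_sum_x0 u : s_sum p br u 0 = 0.
Proof.
apply: s_sum_commute => //; last exact: bilin0l.
exact: (lie_alternating hL).
Qed.

Let s_sum_0x u : s_sum p br 0 u = 0.
Proof. by apply: s_sum_commute => //; rewrite (bilin0r bb). Qed.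

(** The polynomial has degree at most p in s, and its coefficient of s^p is [s_sum p br u u']. *)
Let coef_s_sum u v u' v' n : (p <= n)%N -> s_sum p br u u' = 0 ->
  coefT n (s_sum p brS (lin u v) (lin u' v')) = 0.
Proof.
move=> pn uu0.
(* [f] has degree at most d + 1, with coefficient [z] there. *)
pose R d f z := coefT d.+1 f = z /\ forall m, (d.+1 < m)%N -> coefT m f = 0.
have step w w' d f z : R d f z -> R d.+1 (brS (lin w w') f) (br w z).
  case=> <- fm; split=> [|[//|m] dm]; rewrite coef_br_lin.
    by rewrite (fm d.+2) // (bilin0r bb) addr0.
  by rewrite !fm ?(bilin0r bb) ?addr0 // ltnW.
have [] : R p.-1 (s_sum p brS (lin u v) (lin u' v')) (s_sum p br u u').
  apply: s_sum_rel => [d|d f z h w [<- fm] [<- hm]|d c f z [<- fm]|||].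
  - by split=> *; apply: lin0 (coef_linear _).
  - split=> [|m dm]; rewrite (linD (coef_linear _)) //.
    by rewrite fm // hm // addr0.
  - split=> [|m dm]; rewrite (linZ (coef_linear _)) //.
    by rewrite fm // scaler0.
  - exact: step.
  - exact: step.
  split=> [|m dm]; rewrite (linD (coef_linear _)) !coefTE coefX coef1.
    by rewrite scale1r scale0r addr0.
  by rewrite !gtn_eqF // ?scale0r ?addr0 // ltnW.
rewrite prednK ?(ltnW p1) // uu0 => fp fm.
by move: pn; rewrite leq_eqVlt => /predU1P[<- //|/fm].
Qed.

Let E_s_sum := derivation_s_sum hS hp E_linear (tmap_derivation hB hL euler_der).

(** Replace [u] by [s u]. By [derivation_s_sum] both orders have the same image under [E]; their
    difference vanishes at s = 0 and in degrees from p on, hence at s = 1 by [ev1_eq0]. *)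
Lemma s_sumC u v : s_sum p br u v = s_sum p br v u.
Proof.
apply/eqP; rewrite -subr_eq0; apply/eqP.
pose x := lin u 0; pose y := lin 0 v.
have := @ev1_eq0 (s_sum p brS x y - s_sum p brS y x).
rewrite (linB (ev_linear 1)) (linB (ev_linear 0)) !ev_s_sum.
rewrite !scale1r !scale0r !addr0 !add0r s_sum_x0 s_sum_0x subr0; apply => //.
  rewrite (linB E_linear) !E_s_sum.
  by rewrite (addrC y x) [X in X - _]addrAC subrr.
by move=> n pn; rewrite (linB (coef_linear n)) !coef_s_sum // subr0.
Qed.

(** Again only [u] is scaled by s. Under [E], both sides telescope to
    [T(x+y+z) - T(x) - T(y) - T(z)] with [T(f) = ad_f^{p-1} (E f)]. *)
Lemma s_sum_cocycle u v w :
  s_sum p br u v + s_sum p br (u + v) w = s_sum p br v w + s_sum p br u (v + w).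
Proof.
apply/eqP; rewrite -subr_eq0; apply/eqP.
pose x := lin u 0; pose xy := lin u v; pose y := lin 0 v; pose z := lin 0 w.
pose yz := lin 0 (v + w).
have xyE : x + y = xy by rewrite /x /y /xy /lin !tens0r addr0 add0r.
have yzE : y + z = yz by rewrite /y /z /yz /lin !tens0r !add0r -tensDr.
have xyzE : xy + z = x + yz by rewrite -xyE -yzE; exact/esym/addrA.
have cancel (P a b T c : tensor B L) :
    P - a - b + (T - P - c) = T - a - b - c.
  rewrite addrC -!addrA; congr (_ + _).
  by rewrite [- c + _]addrCA addKr addrC -addrA.
have := @ev1_eq0 (s_sum p brS x y + s_sum p brS xy z -
                  (s_sum p brS y z + s_sum p brS x yz)).
rewrite (linB (ev_linear 1)) (linB (ev_linear 0)) !(linD (ev_linear _)) !ev_s_sum.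
rewrite !scale1r !scale0r !addr0 !add0r !s_sum_0x !addr0 add0r subrr; apply => //.
  rewrite (linB E_linear).
  rewrite !(linD E_linear) !E_s_sum.
  rewrite xyE yzE xyzE cancel.
  rewrite [X in _ - (_ + X)]addrAC cancel [X in _ - X]addrAC.
  by rewrite [X in _ - (X - _)]addrAC subrr.
move=> n pn; rewrite (linB (coef_linear n)) !(linD (coef_linear n)).
by rewrite !coef_s_sum // !addr0 subr0.
Qed.

End Cocycle.

(** * Sums over compositions *)

Lemma sum_pascal (M : zmodType) (m : nat) (G : nat -> M) :
  \sum_(a < m.+1) (G a + G a.+1) *+ 'C(m, a) =
  \sum_(a < m.+2) G a *+ 'C(m.+1, a).
Proof.
under eq_bigr do rewrite mulrnDl.
rewrite big_split /= [in RHS]big_ord_recl /= bin0.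
under [in RHS]eq_bigr do rewrite /bump add1n binS mulrnDr.
rewrite big_split /= addrA; congr (_ + _).
rewrite big_ord_recl bin0 [in RHS]big_ord_recr /=.
by rewrite (@bin_small m m.+1) // mulr0n addr0.
Qed.

Section Compositions.
Variables (k : fieldType) (L : lmodType k) (br rhd : L -> L -> L) (u : L).
Hypotheses (bb : bilinear br) (ld : linear (rhd u))
  (dE : forall x y, rhd u (br x y) = br (rhd u x) y + br x (rhd u y)).
Let d := rhd u.

(* [comp_op q m] is the sum, over the compositions [alpha] of [m] with [q]
   parts, of [comp_coef alpha] times the composite of the [ad_{u^{|> alpha_i}}];
   the recursion splits off the last part [a + 1], whose factor in
   [comp_coef alpha] is ['C(m - 1, a)]. *)
Fixpoint comp_op (q m : nat) (z : L) : L :=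
  if q is q'.+1 then
    \sum_(a < m) comp_op q' (m.-1 - a) (br (iter a d u) z) *+ 'C(m.-1, a)
  else if m == 0%N then z else 0.

Lemma comp_opD q m z z' : comp_op q m (z + z') = comp_op q m z + comp_op q m z'.
Proof.
elim: q m z z' => [|q IH] m z z' /=; first by case: eqP; rewrite ?addr0.
rewrite -big_split /=; apply: eq_bigr => a _.
by rewrite (bilinDr bb) IH mulrnDl.
Qed.

(** With [C_m] the sum over q of [t^q comp_op q m], this is the coefficient of t^q in
    [(t ad_u + d) C_m = C_{m+1} + C_m d]: [d] lengthens a part or reaches the argument, and [t ad_u]
    adds a first part 1. *)
Lemma comp_op_derivation q m z :
  (if q is q'.+1 then br u (comp_op q' m z) else 0) + d (comp_op q m z) =
  comp_op q m.+1 z + comp_op q m (d z).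
Proof.
elim: q m z => [|q IH] m z.
  by rewrite /= !add0r; case: eqP => // _; exact: lin0.
case: m => [|m].
  rewrite /= !big_ord0 big_ord_recl big_ord0 /d (lin0 ld) bin0 subnn /= !addr0.
  by case: q {IH} => [|q] //=; rewrite !big_ord0 (bilin0r bb).
pose prev n w := if q is q'.+1 then br u (comp_op q' n w) else 0.
(* [G a] comes from enlarging the other parts and [G a.+1] from lengthening the last one;
   [sum_pascal] merges the two. *)
pose G a := comp_op q (m.+1 - a) (br (iter a d u) z).
have termE (a : 'I_m.+1) : d (comp_op q (m - a) (br (iter a d u) z)) =
    G a + G a.+1 + comp_op q (m - a) (br (iter a d u) (d z)) -
    prev (m - a)%N (br (iter a d u) z).
  apply/eqP; rewrite eq_sym subr_eq [eqbRHS]addrC; apply/eqP.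
  rewrite [RHS]IH [d (br _ _)]dE comp_opD addrA /G subSS subSn //.
  by rewrite -ltnS.
have prevE : br u (comp_op q m.+1 z) =
    \sum_(a < m.+1) prev (m - a)%N (br (iter a d u) z) *+ 'C(m, a).
  rewrite /prev; case: q {IH prev G termE} => [|q].
    by rewrite (bilin0r bb) big1 // => a _; rewrite mul0rn.
  rewrite (lin_sum (bilinr bb u)); apply: eq_bigr => a _.
  by rewrite (linMn (bilinr bb u)).
rewrite prevE [comp_op _ m.+2 z]/= [comp_op _ m.+1 (d z)]/= -(sum_pascal m G).
rewrite [comp_op _ m.+1 z]/= /d (lin_sum ld) -!big_split /=.
apply: eq_bigr => a _; rewrite (linMn ld) -!mulrnDl -/d termE.
by rewrite [prev _ _ + _]addrC subrK.
Qed.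

(** The index [a] collects the compositions of m + 1 with last part a + 1; that part supplies the
    innermost entry, so q brackets mean q + 1 parts. *)
Lemma iter_polyop_comp_op m q :
  iter m (polyop (br u) d) (const_coef u) q =
  \sum_(a < m.+1) comp_op q (m - a) (iter a d u) *+ 'C(m, a).
Proof.
elim: m q => [|m IH] q.
  by rewrite big_ord1 /= bin0; case: q => //= q; rewrite big_ord0.
pose G a := comp_op q (m.+1 - a) (iter a d u).
rewrite iterS {1}/polyop -(sum_pascal m G).
rewrite IH /d (lin_sum ld) -/d.
have -> : (if q is q'.+1 then br u (iter m (polyop (br u) d) (const_coef u) q')
           else 0) =
    \sum_(a < m.+1) (if q is q'.+1 then br u (comp_op q' (m - a) (iter a d u))
                     else 0) *+ 'C(m, a).
  case: q {G} => [|q]; first by rewrite big1 // => a _; rewrite mul0rn.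
  rewrite IH (lin_sum (bilinr bb u)); apply: eq_bigr => a _.
  by rewrite (linMn (bilinr bb u)).
rewrite -big_split; apply: eq_bigr => a _ /=.
rewrite [d _](linMn ld) -mulrnDl comp_op_derivation /G subSS subSn //.
by rewrite -ltnS.
Qed.

Lemma is_composition_rcons n s a : is_composition n (rcons s a) =
  [&& (0 < a)%N, (a <= n)%N & is_composition (n - a) s].
Proof.
rewrite /is_composition all_rcons sumn_rcons -andbA; case: (0 < a)%N => //=.
case: (leqP a n) => [an|na] /=; first by rewrite -[n in LHS](subnK an) eqn_add2r.
by rewrite gtn_eqF ?andbF // (leq_trans na) ?leq_addl.
Qed.

Lemma comp_coef_rcons s a :
  comp_coef (rcons s a) = (comp_coef s * 'C((sumn s + a).-1, a.-1))%N.
Proof.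
rewrite /comp_coef.
rewrite -(big_mkord xpredT (fun i =>
   'C((sumn (take i.+1 (rcons s a))).-1, (nth 0 (rcons s a) i).-1))).
rewrite size_rcons big_nat_recr //= big_mkord; congr (_ * _)%N.
  apply: eq_bigr => i _; rewrite nth_rcons ltn_ord -cats1 takel_cat //.
by rewrite nth_rcons ltnn eqxx take_oversize ?size_rcons // sumn_rcons.
Qed.

(** The bound [N] on the entries stays fixed while [n] decreases, so inductions keep one tuple
    type. *)
Lemma sum_composition_rcons N r n (F : seq nat -> L) : (n <= N)%N ->
  \sum_(alpha : r.+1.-tuple 'I_N.+1 | is_composition n (map val alpha))
    F (map val alpha) =
  \sum_(a < n)
    \sum_(alpha : r.-tuple 'I_N.+1 | is_composition (n.-1 - a) (map val alpha))
      F (rcons (map val alpha) a.+1).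
Proof.
move=> nN; pose h (w : 'I_N.+1 * r.-tuple 'I_N.+1) := [tuple of rcons w.2 w.1].
pose H a := \sum_(alpha : r.-tuple 'I_N.+1 |
    is_composition n (rcons (map val alpha) a)) F (rcons (map val alpha) a).
rewrite (reindex h) /=; last first.
  (* The last entry is read off as the head of the reversal. *)
  pose h' (t : r.+1.-tuple 'I_N.+1) :=
    (thead [tuple of rev t], [tuple of rev (behead [tuple of rev t])]).
  exists h' => [[x t] _|t _].
    congr (_, _); last apply: val_inj; rewrite /= ?rev_rcons /= ?revK //.
    by rewrite /thead (tnth_nth x) /= rev_rcons.
  apply: val_inj; rewrite /= -rev_cons; apply: (canLR revK).
  exact/esym/(congr1 val (tuple_eta [tuple of rev t])).
transitivity (\sum_(x < N.+1) H x).
  rewrite pair_big_dep; apply: eq_big => [[x t]|[x t] _] /=.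
    by rewrite map_rcons.
  by rewrite map_rcons.
(* A last part 0 is excluded, and one larger than [n] admits no composition. *)
rewrite big_ord_recl {1}/H big1 ?add0r => [|t]; last first.
  by rewrite is_composition_rcons.
transitivity (\sum_(a < n) H a.+1).
  rewrite (big_ord_widen N (fun a => H a.+1) nN) [RHS]big_mkcond.
  apply: eq_bigr => a _; case: ltnP => // na; rewrite /H big1 // => t.
  by rewrite is_composition_rcons /= ltnNge na.
apply: eq_bigr => a _; apply: eq_bigl => t; rewrite is_composition_rcons.
by case: n a {nN H} => [[]//|n] a /=; rewrite ltn_ord subSS.
Qed.

Lemma sum_comp_op N r n z : (n <= N)%N ->
  \sum_(alpha : r.-tuple 'I_N.+1 | is_composition n (map val alpha))
    (comp_coef (map val alpha))%:R *:
      foldr (fun a w => br (rhd_pow rhd u a) w) z (map val alpha) =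
  comp_op r n z.
Proof.
elim: r n z => [|r IH] n z nN.
  rewrite big_mkcond (bigD1 [tuple]) //= big1 => [|t]; last by rewrite tuple0 => /eqP.
  by rewrite /is_composition /comp_coef big_ord0 /= eq_sym scale1r addr0.
rewrite (@sum_composition_rcons N r n (fun s => (comp_coef s)%:R *:
  foldr (fun a w => br (rhd_pow rhd u a) w) z s)) //=.
apply: eq_bigr => a _; have an : (n.-1 - a <= N)%N.
  by rewrite (leq_trans _ nN) // (leq_trans (leq_subr _ _)) // leq_pred.
rewrite -(IH _ _ an) -sumrMnl; apply: eq_bigr => t /andP[_ /eqP tE].
rewrite comp_coef_rcons foldr_rcons tE /= addnS /= subnK; last first.
  by case: n a {nN an tE} => [[]|n] //= a; rewrite -ltnS.
by rewrite natrM mulrC -scalerA scaler_nat.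
Qed.

Lemma nested_bracket_rcons s a : nested_bracket br rhd u (rcons s a) =
  foldr (fun b w => br (rhd_pow rhd u b) w) (rhd_pow rhd u a) s.
Proof. by elim: s => [|b s IH] //; rewrite [RHS]/= -IH; case: s {IH}. Qed.

Lemma sum_nested_bracket N r n : (0 < n <= N)%N ->
  \sum_(alpha : r.+1.-tuple 'I_N.+1 | is_composition n (map val alpha))
    (comp_coef (map val alpha))%:R *: nested_bracket br rhd u (map val alpha) =
  iter n.-1 (polyop (br u) (rhd u)) (const_coef u) r.
Proof.
case: n => //= n nN; rewrite iter_polyop_comp_op.
rewrite (@sum_composition_rcons N r n.+1 (fun s => (comp_coef s)%:R *:
  nested_bracket br rhd u s)) //=.
apply: eq_bigr => a _; have an : (n - a <= N)%N.
  by rewrite (leq_trans (leq_subr _ _)) // ltnW.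
rewrite -(sum_comp_op _ _ an) -sumrMnl; apply: eq_bigr => t /andP[_ /eqP tE].
rewrite comp_coef_rcons nested_bracket_rcons tE /= addnS /= subnK; last first.
  by rewrite -ltnS.
by rewrite natrM mulrC -scalerA scaler_nat.
Qed.

(** Compositions with r parts match the coefficient of t^(r-1), with the same factor 1/r as in
    [s_term]. *)
Lemma sub_pmapE p (pm : L -> L) : (0 < p)%N ->
  sub_pmap p br pm rhd u = pm u + jacobson_sum p (br u) (rhd u) u.
Proof.
move=> p0; rewrite /sub_pmap; congr (_ + _); apply: eq_big_nat => -[//|r] _.
by rewrite sum_nested_bracket ?p0 ?leqnn.
Qed.

End Compositions.

(** * The restricted post-Lie algebra on A (x) g *)

Section CurrentPostLie.
Variables (k : fieldType) (p : nat) (hp : p \in [pchar k]).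
Variables (g : lmodType k) (br : g -> g -> g) (pm : g -> g).
Hypothesis hg : restricted_lie_algebra p br pm.
Variables (A : lmodType k) (mul : A -> A -> A) (hA : comm_assoc_algebra mul).

Let bm : bilinear mul := calg_bilinear hA.
Let hL : lie_algebra br := rlie_lie hg.
Let bb : bilinear br := lie_bilinear hL.
Let p0 : (0 < p)%N := prime_gt0 (pcharf_prime hp).
Let p1 : (1 < p)%N := prime_gt1 (pcharf_prime hp).
Let pE : p = p.-1.+1 := esym (prednK p0).

Let mulCA a b c : mul a (mul b c) = mul b (mul a c).
Proof. by rewrite !(calg_assoc hA) (calg_comm hA a b). Qed.

(* [k * A] is the unitization of [A]; [umul] is the action of [A] on it. *)
Definition umul (a : A) (z : k^o * A) : k^o * A := (0, z.1 *: a + mul a z.2).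

Lemma umul_bilinear : bilinear umul.
Proof.
split=> [z|a] c w w'; congr (_, _) => /=; rewrite ?scaler0 ?addr0 //.
  rewrite (bilinDl bm) (bilinZl bm) !scalerDr addrACA; congr (_ + _ + _).
  by rewrite !scalerA mulrC.
rewrite (bilinDr bm) (bilinZr bm) scalerDl scalerDr addrACA.
by rewrite scalerA.
Qed.

Lemma umulA a b z : umul a (umul b z) = umul (mul a b) z.
Proof.
congr (_, _); rewrite /= scale0r add0r (bilinDr bm) (bilinZr bm).
by rewrite (calg_assoc hA).
Qed.

Lemma umul1 a : umul a (1, 0) = (0, a).
Proof. by rewrite /umul /= scale1r (bilin0r bm) addr0. Qed.

Lemma iter_umul n a z : iter n.+1 (umul a) z = umul (alg_pow mul a n.+1) z.
Proof. by elim: n => // n IH; rewrite iterS IH umulA. Qed.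

Lemma iter_mul n a b : iter n.+1 (mul a) b = mul (alg_pow mul a n.+1) b.
Proof. by elim: n => // n IH; rewrite iterS IH (calg_assoc hA). Qed.

Lemma alg_powZ n c a : alg_pow mul (c *: a) n.+1 = c ^+ n.+1 *: alg_pow mul a n.+1.
Proof.
elim: n => // n; rewrite /alg_pow /= => ->.
by rewrite (bilinZl bm) (bilinZr bm) scalerA -exprS.
Qed.

(** Jacobson's formula for [A] with zero bracket acting by [umul], evaluated at the unit
    [(1, 0)]. *)
Lemma alg_powD a b :
  alg_pow mul (a + b) p = alg_pow mul a p + alg_pow mul b p.
Proof.
pose z (_ _ : A) : A := 0.
have bz : bilinear z by split=> ? c x y; rewrite /z /= scaler0 addr0.
have zE x y v : umul (z x y) v = umul x (umul y v) - umul y (umul x v).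
  by rewrite (bilin0l umul_bilinear) !umulA (calg_comm hA) subrr.
have := jacobson_rep hp umul_bilinear zE a b (1, 0).
rewrite (s_sum_commute p1 bz) // (bilin0l umul_bilinear) addr0.
by rewrite {1 2 3}pE !iter_umul !umul1 -pE => -[_ ->].
Qed.

Lemma derivation_alg_pow (d : A -> A) a : derivation mul d ->
  d (alg_pow mul a p) = 0.
Proof.
move=> [ld dE].
have dn n : d (alg_pow mul a n.+1) = iter n (mul a) (d a) *+ n.+1.
  elim: n => // n IH; rewrite {1}/alg_pow iterS dE -/(alg_pow mul a n.+1) IH.
  rewrite (linMn (bilinr bm a)) -iterS [in RHS]mulrS; congr (_ + _).
  case: n {IH} => [|n]; first by rewrite /= (calg_comm hA).
  by rewrite [RHS]iter_mul (calg_comm hA).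
by rewrite pE dn -pE (pchar_scale hp).
Qed.

Definition brT : tensor A g -> tensor A g -> tensor A g := tmap2 mul br.

Lemma brT_lie : lie_algebra brT.
Proof. exact: current_lie. Qed.

Let bT : bilinear brT := lie_bilinear brT_lie.

Lemma brTE a x b y : brT (tens a x) (tens b y) = tens (mul a b) (br x y).
Proof. exact: tmap2E. Qed.

Notation Lam := (s_sum p brT).

Let Lam0x x : Lam 0 x = 0.
Proof. by apply: s_sum_commute; rewrite ?(bilin0r bT). Qed.

Let Lamx0 x : Lam x 0 = 0.
Proof.
apply: s_sum_commute => //; last exact: bilin0l.
exact: (lie_alternating brT_lie).
Qed.

Lemma s_sum_tensl a b x : Lam (tens a x) (tens b x) = 0.
Proof.
by apply: s_sum_commute; rewrite ?brTE ?(lie_alternating hL) ?tens0r.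
Qed.

(** A bracket of d + 1 entries carries the factor [a^(d+1)], and [s_sum] is homogeneous of degree
    p. *)
Lemma s_sum_tensr a x y :
  Lam (tens a x) (tens a y) = tens (alg_pow mul a p) (s_sum p br x y).
Proof.
rewrite [X in alg_pow _ _ X]pE.
apply: (@s_sum_rel _ p _ _ brT br (fun d f z => f = tens (alg_pow mul a d.+1) z)).
- by move=> d; rewrite tens0r.
- by move=> d f z h w -> ->; rewrite tensDr.
- by move=> d c f z ->; rewrite tensZr.
- by move=> d f z ->; rewrite brTE.
- by move=> d f z ->; rewrite brTE.
- by [].
Qed.

Lemma s_sumZ c x y : Lam (c *: x) (c *: y) = c ^+ p *: Lam x y.
Proof.
rewrite [X in _ ^+ X]pE.
apply: (@s_sum_rel _ p _ _ brT brT (fun d f z => f = c ^+ d.+1 *: z)).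
- by move=> d; rewrite scaler0.
- by move=> d f z h w -> ->; rewrite scalerDr.
- by move=> d e f z ->; rewrite !scalerA mulrC.
- by move=> d f z ->; rewrite (bilinZl bT) (bilinZr bT) scalerA -exprS.
- by move=> d f z ->; rewrite (bilinZl bT) (bilinZr bT) scalerA -exprS.
- by rewrite expr1.
Qed.

(** * The p-map on A (x) g *)

Notation tpi := (\pi_(tensor A g)).

Definition powT (a : A) (x : g) : tensor A g := tens (alg_pow mul a p) (pm x).

Fixpoint pm_seq (s : seq (A * g)) : tensor A g :=
  if s is w :: s' then
    powT w.1 w.2 + pm_seq s' + Lam (tens w.1 w.2) (tpi s')
  else 0.

Let piD s t : tpi (s ++ t) = tpi s + tpi t :> tensor A g.
Proof. by rewrite [RHS]tensor_addE. Qed.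

Let pi0 : tpi [::] = 0.
Proof. by []. Qed.

(** The cocycle identity makes the extension rule independent of the bracketing of the sum. *)
Lemma pm_seq_cat s t :
  pm_seq (s ++ t) = pm_seq s + pm_seq t + Lam (tpi s) (tpi t).
Proof.
elim: s => [|[a x] s IH] /=; first by rewrite pi0 Lam0x add0r addr0.
rewrite -[_ :: s]cat1s IH !piD -/(tens a x) [X in _ = X + _]addrAC -[RHS]addrA.
by rewrite (s_sum_cocycle hp brT_lie) !addrA.
Qed.

Lemma pm_seq1 a x : pm_seq [:: (a, x)] = powT a x.
Proof. by rewrite /= pi0 Lamx0 !addr0. Qed.

(** Reordering is the symmetry of [s_sum]. Additivity on the left is Frobenius, as the correction
    vanishes; on the right it is the rule for [pm], scaled by [s_sum_tensr]. *)
Lemma pm_seq_rel s t : tensor_rel s t -> pm_seq s = pm_seq t.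
Proof.
elim=> {s t} [//|s t _ -> //|s t r _ -> _ -> //|s s' t t' ss IH tt IH'|s t|x|a b x
             |a x y|c a x].
- rewrite !pm_seq_cat IH IH'.
  by move/tensor_eqP: ss => ->; move/tensor_eqP: tt => ->.
- by rewrite !pm_seq_cat (s_sumC hp brT_lie) [pm_seq s + _]addrC.
- rewrite pm_seq1 /powT -(scale0r (0 : A)) pE alg_powZ expr0n scale0r.
  exact: tens0l.
- rewrite -[[:: _; _]]cat1s pm_seq_cat !pm_seq1 s_sum_tensl addr0 /powT alg_powD.
  exact: tensDl.
- rewrite -[[:: _; _]]cat1s pm_seq_cat !pm_seq1 s_sum_tensr /powT (rlie_add hg).
  by rewrite !tensDr.
- rewrite !pm_seq1 /powT (rlie_scale hg) [X in alg_pow _ _ X]pE alg_powZ -pE.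
  by rewrite tensZl tensZr.
Qed.

Definition pmT (x : tensor A g) : tensor A g := pm_seq (repr x).

Lemma pmT_pi s : pmT (tpi s) = pm_seq s.
Proof. exact/pm_seq_rel/tensor_repr. Qed.

Lemma pmTE a x : pmT (tens a x) = powT a x.
Proof. by rewrite [LHS]pmT_pi pm_seq1. Qed.

Lemma pmT_add x y : pmT (x + y) = pmT x + pmT y + Lam x y.
Proof.
case: (tensorP x) (tensorP y) => s -> [t ->].
by rewrite -piD !pmT_pi pm_seq_cat.
Qed.

Lemma pmT_scale c x : pmT (c *: x) = c ^+ p *: pmT x.
Proof.
move: x; apply: tensor_ind => [a x|x y IH IH'].
  by rewrite -tensZl !pmTE /powT [X in alg_pow _ _ X]pE alg_powZ -pE tensZl.
by rewrite scalerDr !pmT_add IH IH' s_sumZ !scalerDr.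
Qed.

(** By Jacobson's formula both sides obey the same rule on sums, so pure tensors suffice. *)
Lemma pmT_rep (V : lmodType k) (X : tensor A g -> V -> V) : bilinear X ->
  (forall x y v, X (brT x y) v = X x (X y v) - X y (X x v)) ->
  (forall a x v, X (powT a x) v = iter p (X (tens a x)) v) ->
  forall x v, X (pmT x) v = iter p (X x) v.
Proof.
move=> bX XE Xp x v; move: x; apply: tensor_ind => [a x|x y IH IH'].
  by rewrite pmTE Xp.
by rewrite pmT_add (jacobson_rep hp bX XE) !(bilinDl bX) IH IH'.
Qed.

Lemma brT_pmT x y : brT (pmT x) y = iter p (brT x) y.
Proof.
apply: (pmT_rep bT (lie_ad_br brT_lie)) => a z.
have iter_linear n : linear (iter n (brT (tens a z))).
  by elim: n => [|n IH] c w w' //=; rewrite IH (bT.2 (tens a z)).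
apply: (linear_tensor_eq (bT.2 _) (iter_linear p)) => b w.
rewrite brTE (rlie_ad hg) [X in alg_pow _ _ X]pE -iter_mul -pE.
by elim: p => // n IH; rewrite !iterS -IH brTE.
Qed.

Lemma brT_restricted : restricted_lie_algebra p brT pmT.
Proof.
split; [exact: brT_lie|exact: pmT_scale|exact: brT_pmT|exact: pmT_add].
Qed.

(** * The action on A and the post-Lie product *)

Variables (rho : g -> A -> A) (hrho : restricted_der_hom p br pm mul rho).

Lemma rho_bilinear : bilinear rho.
Proof.
split=> [a c x y|x]; first exact: (rdh_linear hrho).
exact: der_linear (rdh_der hrho x).
Qed.
Let brho := rho_bilinear.

Definition actT (x : tensor A g) (b : A) : A :=
  tlift (fun a y => mul a (rho y b)) x.

Let act_bil b : bilinear (fun a y => mul a (rho y b)).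
Proof.
split=> [y|a] c w w' /=; first by rewrite (bilinDl bm) (bilinZl bm).
by rewrite (bilinDl brho) (bilinZl brho) (bilinDr bm) (bilinZr bm).
Qed.

Lemma actT_bilinear : bilinear actT.
Proof.
split=> [b|x]; first exact: tlift_linear (act_bil b).
pose F m a y := mul a (rho y m).
apply: (@tlift_param_linear _ _ _ _ _ F) => a y c w w'.
by rewrite /F (bilinDr brho) (bilinZr brho) (bilinDr bm) (bilinZr bm).
Qed.
Let ba := actT_bilinear.

Lemma actTE a x b : actT (tens a x) b = mul a (rho x b).
Proof. exact: (tliftE a x (act_bil b)). Qed.

Lemma actT_derivation x : derivation mul (actT x).
Proof.
split=> [|b c]; first exact: ba.2.
move: x; apply: tensor_ind => [a x|x y IH IH'].
  rewrite !actTE (der_leibniz (rdh_der hrho x)) (bilinDr bm) (calg_assoc hA).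
  by rewrite mulCA.
by rewrite !(bilinDl ba) IH IH' (bilinDl bm) (bilinDr bm) addrACA.
Qed.

Definition rhdT (x : tensor A g) : tensor A g -> tensor A g := tmap (actT x).

Lemma rhdTE x b y : rhdT x (tens b y) = tens (actT x b) y.
Proof. exact: tmapE (ba.2 x) b y. Qed.

Lemma rhdT_bilinear : bilinear rhdT.
Proof.
split=> [y|x]; last exact: tmap_linear (ba.2 x).
pose F m b (z : g) := tens (actT m b) z.
rewrite -[rhdT^~ y]/(fun m => tlift (F m) y).
apply: tlift_param_linear => b z c w w'.
by rewrite /F (bilinDl ba) (bilinZl ba) tensDl tensZl.
Qed.
Let brh := rhdT_bilinear.

Lemma rhdT_derivation x y z :
  rhdT x (brT y z) = brT (rhdT x y) z + brT y (rhdT x z).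
Proof. exact: (tmap_derivation hA hL (actT_derivation x)). Qed.

(** Since [rhdT x] is [actT x] on the left factor, the last post-Lie axiom reduces to this; on pure
    tensors it is the commutator of the derivations [a rho(x)] and [c rho(y)]. *)
Lemma actT_commutator x y b :
  actT (brT x y + rhdT x y - rhdT y x) b = actT x (actT y b) - actT y (actT x b).
Proof.
rewrite (bilinDl ba) (bilinNl ba) (bilinDl ba).
move: x; apply: tensor_ind => [a x|x x' IH IH']; last first.
  rewrite (bilinDl bT) (bilinDl brh) (bilinDr brh) !(bilinDl ba) (bilinDr ba).
  by rewrite !opprD (addrACA (actT x _)) -IH -IH' (addrACA (actT (brT x y) b)) [LHS]addrACA.
move: y; apply: tensor_ind => [c y|y y' IH IH']; last first.
  rewrite (bilinDr bT) (bilinDr brh) (bilinDl brh) !(bilinDl ba) (bilinDr ba).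
  by rewrite !opprD (addrACA (actT (tens a x) _)) -IH -IH' (addrACA (actT (brT _ y) b)) [LHS]addrACA.
rewrite brTE !rhdTE !actTE (rdh_br hrho) !(der_leibniz (rdh_der hrho _)).
rewrite !(bilinDr bm) !(bilinNr bm) !(calg_assoc hA).
rewrite [mul c a](calg_comm hA) [in RHS]opprD [X in _ = X + _]addrC.
by rewrite [X in X - _ = _]addrAC -[LHS]addrA [X in _ = _ + X]addrC.
Qed.

Lemma post_lieT : post_lie_algebra brT rhdT.
Proof.
split=> [||x y z|x y z]; [exact: brT_lie|exact: brh|exact: rhdT_derivation|].
move: z; apply: tensor_ind => [b z|z z' IH IH'].
  by rewrite !rhdTE actT_commutator tensDl -scaleN1r tensZl scaleN1r.
by rewrite !(bilinDr brh) IH IH' opprD addrACA.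
Qed.

(** On a pure tensor both sides vanish: a derivation kills [a^p], and the first bracket contains
    [br x x]. Sums follow from [derivation_s_sum]. *)
Lemma rhdT_pmT x y : rhdT y (pmT x) = iter p.-1 (brT x) (rhdT y x).
Proof.
move: x; apply: tensor_ind => [a x|x x' IH IH'].
  rewrite pmTE /powT !rhdTE (derivation_alg_pow _ (actT_derivation y)) tens0l.
  have -> : p.-1 = p.-2.+1 by case: p p1 => [|[]].
  rewrite iterSr brTE.
  rewrite (lie_alternating hL) tens0r; elim: p.-2 => //= n <-.
  by rewrite (bilin0r bT).
rewrite pmT_add !(bilinDr brh) IH IH'.
rewrite (derivation_s_sum brT_lie hp (brh.2 y) (rhdT_derivation y)).
by rewrite (bilinDr brh) -[X in _ + X]addrA -opprD [LHS]addrC subrK.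
Qed.

(** * The representation on (k + A) (x) A *)

Definition thetaT := tmap2 umul rho.
Let bth : bilinear thetaT := tmap2_bilinear umul_bilinear brho.

Lemma thetaTE a x z c : thetaT (tens a x) (tens z c) = tens (umul a z) (rho x c).
Proof. exact: (tmap2E umul_bilinear brho). Qed.

Lemma thetaT_br x y v :
  thetaT (brT x y) v = thetaT x (thetaT y v) - thetaT y (thetaT x v).
Proof.
move: v; apply: tensor_ind => [z c|v v' IH IH']; last first.
  by rewrite !(bilinDr bth) IH IH' opprD addrACA.
move: x; apply: tensor_ind => [a x|x x' IH IH']; last first.
  by rewrite (bilinDl bT) !(bilinDl bth) (bilinDr bth) IH IH' opprD addrACA.
move: y; apply: tensor_ind => [b y|y y' IH IH']; last first.
  by rewrite (bilinDr bT) !(bilinDl bth) (bilinDr bth) IH IH' opprD addrACA.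
rewrite brTE !thetaTE !umulA (rdh_br hrho) (calg_comm hA b a) tensDr.
by rewrite -scaleN1r tensZr scaleN1r.
Qed.

Lemma thetaT_pmT x v : thetaT (pmT x) v = iter p (thetaT x) v.
Proof.
apply: (pmT_rep bth thetaT_br) => a z.
have iter_linear n : linear (iter n (thetaT (tens a z))).
  by elim: n => [|n IH] c w w' //=; rewrite IH (bth.2 (tens a z)).
apply: (linear_tensor_eq (bth.2 _) (iter_linear p)) => b w.
rewrite thetaTE (rdh_pm hrho) [X in alg_pow _ _ X]pE -iter_umul -pE.
by elim: p => // n IH; rewrite !iterS -IH thetaTE.
Qed.

(** The derivation extended to the unitization, killing the unit. *)
Definition uact (x : tensor A g) (z : k^o * A) : k^o * A := (0, actT x z.2).

Lemma uact_linear x : linear (uact x).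
Proof.
move=> c z z'; congr (_, _); rewrite /= ?scaler0 ?addr0 //.
by rewrite (bilinDr ba) (bilinZr ba).
Qed.

Definition umulT : tensor (k^o * A)%type A -> A :=
  tlift (fun (z : k^o * A) (c : A) => z.1 *: c + mul z.2 c).

Let umulT_bil : bilinear (fun (z : k^o * A) (c : A) => z.1 *: c + mul z.2 c).
Proof.
split=> [b|z] c w w' /=.
  rewrite (bilinDl bm) (bilinZl bm) scalerDl scalerDr addrACA.
  by rewrite !scalerA.
rewrite (bilinDr bm) (bilinZr bm) !scalerDr addrACA; congr (_ + _ + _).
by rewrite !scalerA mulrC.
Qed.
Let umulT_linear : linear umulT := tlift_linear umulT_bil.

Lemma umulTE z c : umulT (tens z c) = z.1 *: c + mul z.2 c.
Proof. exact: (tliftE z c umulT_bil). Qed.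

(** Leibniz rule for a product: [thetaT x] differentiates the right factor, [uact x] the left
    one. *)
Lemma actT_umulT x v :
  actT x (umulT v) = umulT (thetaT x v + tmap (uact x) v).
Proof.
have lu := tmap_linear (V := A) (uact_linear x).
rewrite (linD umulT_linear).
move: v; apply: tensor_ind => [z c|v v' IH IH']; last first.
  rewrite (linD umulT_linear) (bilinDr ba) IH IH' (bilinDr bth) (linD lu).
  by rewrite !(linD umulT_linear) addrACA.
rewrite (tmapE (uact_linear x)) !umulTE /= scale0r add0r.
rewrite (bilinDr ba) (bilinZr ba) (der_leibniz (actT_derivation x)).
rewrite addrCA addrC; congr (_ + _).
move: x {lu}; apply: tensor_ind => [a x|x x' IH IH'].
  rewrite thetaTE umulTE !actTE /= scale0r add0r (bilinDl bm) (bilinZl bm).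
  by rewrite mulCA (calg_assoc hA).
rewrite (bilinDl bth) (linD umulT_linear) -IH -IH' !(bilinDl ba).
by rewrite scalerDr (bilinDr bm) addrACA.
Qed.

(** The commutator hypothesis of [jacobson] for [Y = tmap (uact x)], with [b = rhdT x]. *)
Lemma thetaT_uact x w v : thetaT (rhdT x w) v =
  tmap (uact x) (thetaT w v) - thetaT w (tmap (uact x) v).
Proof.
have lu := tmap_linear (V := A) (uact_linear x).
move: v; apply: tensor_ind => [z c|v v' IH IH']; last first.
  by rewrite !(bilinDr bth) !(linD lu) (bilinDr bth) IH IH' opprD addrACA.
move: w; apply: tensor_ind => [a y|w w' IH IH']; last first.
  by rewrite (bilinDr brh) !(bilinDl bth) (linD lu) IH IH' opprD addrACA.
rewrite rhdTE !(tmapE (uact_linear x)) !thetaTE (tmapE (uact_linear x)).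
rewrite -scaleN1r -tensZl -tensDl scaleN1r; congr (tens _ _).
congr (_, _); rewrite /= ?subr0 // scale0r add0r (bilinDr ba) (bilinZr ba).
by rewrite (der_leibniz (actT_derivation x)) addrA addrK.
Qed.

(* The derivation [actT x] of [A] is what [thetaT x + uact x] induces under
   multiplication, so its [p]-th power is computed by Jacobson's formula. *)
Lemma actT_sub_pmap x b : actT (sub_pmap p brT pmT rhdT x) b = iter p (actT x) b.
Proof.
have lu := tmap_linear (V := A) (uact_linear x).
rewrite (sub_pmapE bT (brh.2 x) (rhdT_derivation x)) //.
pose one : tensor (k^o * A)%type A := tens (1, 0) b.
have one_theta z : umulT (thetaT z one) = actT z b.
  move: z; apply: tensor_ind => [a z|z z' IH IH']; last first.
    by rewrite (bilinDl bth) (linD umulT_linear) IH IH' (bilinDl ba).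
  by rewrite thetaTE umul1 umulTE /= scale0r add0r actTE.
have iterE n : umulT (iter n (fun v => thetaT x v + tmap (uact x) v) one) =
    iter n (actT x) b.
  elim: n => [|n IH]; last by rewrite !iterS -IH actT_umulT.
  by rewrite umulTE /= scale1r (bilin0l bm) addr0.
rewrite -iterE (jacobson bth lu (thetaT_br x) (thetaT_uact x) hp).
rewrite -thetaT_pmT !(linD umulT_linear) !one_theta (bilinDl ba).
(* [uact x] kills the unit, so the p-th power of the second operator contributes nothing. *)
suff -> : iter p (tmap (uact x)) one = 0 by rewrite (lin0 umulT_linear) addr0.
rewrite pE iterSr (tmapE (uact_linear x)) /uact /= (bilin0r ba) tens0l.
by elim: p.-1 => //= n ->; exact: lin0 lu.
Qed.

Lemma rhdT_sub_pmap x y :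
  rhdT (sub_pmap p brT pmT rhdT x) y = iter p (rhdT x) y.
Proof.
have iter_linear n : linear (iter n (rhdT x)).
  by elim: n => [|n IH] c w w' //=; rewrite IH (brh.2 x).
apply: (linear_tensor_eq (brh.2 _) (iter_linear p)) => b z.
rewrite rhdTE actT_sub_pmap.
by elim: p => // n IH; rewrite !iterS -IH rhdTE.
Qed.

Lemma restricted_post_lieT : restricted_post_lie_algebra p brT pmT rhdT.
Proof.
split; [exact: post_lieT|exact: brT_restricted|exact: rhdT_pmT|].
exact: rhdT_sub_pmap.
Qed.

Lemma current_operationsT : current_operations p br pm mul rho brT pmT rhdT.
Proof.
split; [exact: bT| |exact: brh| |exact: pmTE|exact: pmT_add].
  by move=> a b x y; rewrite brTE.
by move=> a b x y; rewrite rhdTE actTE.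
Qed.

Lemma current_operations_unique brT' pmT' rhdT' :
  current_operations p br pm mul rho brT' pmT' rhdT' ->
  [/\ brT' =2 brT, pmT' =1 pmT & rhdT' =2 rhdT].
Proof.
case=> bT' bTE' brh' rhE' pmE' pmD'.
have brE : brT' =2 brT.
  move=> x; apply: (linear_tensor_eq (bT'.2 x) (bT.2 x)) => b y; move: x.
  by apply: (linear_tensor_eq (bT'.1 _) (bT.1 _)) => a x; rewrite bTE' brTE.
split=> // [|x].
  apply: tensor_ind => [a x|x y IH IH']; first by rewrite pmE' pmTE.
  rewrite pmD' IH IH' pmT_add; congr (_ + _).
  (* The rule for [pmT'] involves [brT'], so the brackets must be identified as functions. *)
  suff -> : brT' = brT by [].
  by apply: boolp.funext => z; apply: boolp.funext.
apply: (linear_tensor_eq (brh'.2 x) (brh.2 x)) => b y; move: x.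
apply: (linear_tensor_eq (brh'.1 _) (brh.1 _)) => a x.
by rewrite rhE' rhdTE actTE.
Qed.

End CurrentPostLie.

Theorem theorem3p9 (k : closedFieldType) (p : nat) (hp : p \in [pchar k]%R)
    (g : lmodType k) (br : g -> g -> g) (pm : g -> g)
    (hg : restricted_lie_algebra p br pm)
    (A : lmodType k) (mul : A -> A -> A) (hA : comm_assoc_algebra mul)
    (rho : g -> A -> A) (hrho : restricted_der_hom p br pm mul rho) :
  exists (brT : tensor A g -> tensor A g -> tensor A g)
         (pmT : tensor A g -> tensor A g)
         (rhdT : tensor A g -> tensor A g -> tensor A g),
    [/\ current_operations p br pm mul rho brT pmT rhdT,
        (forall brT' pmT' rhdT',
           current_operations p br pm mul rho brT' pmT' rhdT' ->
           [/\ brT' =2 brT, pmT' =1 pmT & rhdT' =2 rhdT])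
      & restricted_post_lie_algebra p brT pmT rhdT].
Proof.
exists (brT br mul), (pmT p br pm mul), (rhdT mul rho); split.
- exact: current_operationsT.
- exact: current_operations_unique.
- exact: restricted_post_lieT.
Qed.
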